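(* Let $G\subset\mathbb{R}^4$ be the 1-skeleton of the hypercube $\{4,3,3\}$ with vertex set $\{\pm1\}^4$, let $\Gamma=G/\{\pm I\}\subset\mathbb{P}^3$ be the 1-skeleton of the hemi-hypercube, let $c$ be a chiral colouring of $\Gamma$ with four colours, and let $\hat c$ be the colouring of the edges of $G$ in which each edge receives the colour of its image in $\Gamma$. Let $\hat{\mathcal{Q}}$ be the structure in $\mathbb{R}^4$ whose vertices and edges are those of $G$, whose 2-faces are the connected components of the subgraphs of $G$ formed by the edges of exactly two given colours of $\hat c$, and whose facets (3-faces) are the connected components of the subgraphs of $G$ formed by the edges of exactly three given colours of $\hat c$. Then $\hat{\mathcal{Q}}$ is a chiral 4-polytope of full rank; that is, $\hat{\mathcal{Q}}$ is a finite abstract 4-polytope, realised in Euclidean 4-space $\mathbb{R}^4$, that is geometrically chiral.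
   Context: **Graphs.** The hypercube graph $G$ has vertex set $\{\pm1\}^4\subset\mathbb{R}^4$, with $x,y$ joined by an edge (the straight segment) when they differ in exactly one coordinate $i\in\{1,2,3,4\}$; $i$ is the direction of the edge. (Rescaling the vertices to lie on the unit sphere $\mathbb{S}^3$ makes no difference.) The graph $\Gamma$ is the quotient of $G$ by the central inversion $x\mapsto -x$: its vertices are the 8 classes $[x]=[-x]$, $x\in\{\pm1\}^4$, and its 16 edges are the pairs of antipodal edges of $G$, each having a well-defined direction. $\Gamma$ is isomorphic to the complete bipartite graph $K_{4,4}$. **Chiral colourings.** A chiral colouring of $\Gamma$ is an assignment of one of four colours to each edge of $\Gamma$ such that each colour class is a perfect matching of $\Gamma$ (four pairwise disjoint edges covering all vertices) and each colour class contains exactly one edge in each of the four directions. Up to renaming the colours there are exactly two chiral colourings; they are mirror images of each other. **Face poset.** The faces of $\hat{\mathcal{Q}}$ are: a least face of rank $-1$; the vertices (rank 0) and edges (rank 1) of $G$; the 2-faces and 3-faces described in the claim, regarded as subgraphs of $G$; and a greatest face of rank 4 (all of $G$). They are ordered by inclusion. A flag is a maximal chain of faces; two flags are adjacent if they differ in exactly one face. **Abstract polytope.** An abstract $n$-polytope is a poset with a least face (rank $-1$) and a greatest face (rank $n$) such that: every flag (maximal chain) has exactly $n+2$ faces, so that the poset is ranked; the diamond condition holds (whenever $F<H$ with $\operatorname{rank}H-\operatorname{rank}F=2$ there are exactly two faces strictly between $F$ and $H$); and the poset is strongly flag-connected (any two flags $\Phi,\Psi$ can be joined by a sequence of successively adjacent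 flags, all containing $\Phi\cap\Psi$). **Full rank and chirality.** A finite $n$-polytope is of full rank if it is realised in Euclidean $n$-space. The polytope $\hat{\mathcal{Q}}$ is realised in $\mathbb{R}^4$ with its vertices being the points of $\{\pm1\}^4$, its edges being the straight segments of $G$, and its faces of higher rank being subgraphs of $G\subset\mathbb{R}^4$. A symmetry of $\hat{\mathcal{Q}}$ is an isometry of $\mathbb{R}^4$ that maps the set of faces of each rank of the polytope onto itself. The polytope is (geometrically) chiral if the action of its symmetry group on its set of flags has exactly two orbits and any two adjacent flags lie in different orbits. *)

(* Defs.v *)
From mathcomp Require Import all_boot all_order all_algebra.
From mathcomp Require Import lra.
Set Implicit Arguments.
Unset Strict Implicit.
Unset Printing Implicit Defensive.
Import Order.TTheory GRing.Theory Num.Theory.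
Local Open Scope set_scope.

(* A finite poset is given by its carrier [P], a subset of a finite type [T],
   and a boolean relation [le] on [T], of which only the restriction to [P]
   matters. *)

Definition partial_order_on (T : finType) (le : rel T) (P : {set T}) : Prop :=
  [/\ {in P, reflexive le}, {in P &, antisymmetric le}
    & {in P & &, transitive le}].

Definition slt (T : finType) (le : rel T) : rel T :=
  fun x y => (x != y) && le x y.

Definition chain (T : finType) (le : rel T) (P : {set T}) : pred {set T} :=
  fun C => (C \subset P) && [forall x in C, forall y in C, le x y || le y x].

Definition flag (T : finType) (le : rel T) (P : {set T}) : pred {set T} :=
  fun Phi => maxset (chain le P) Phi.

Definition adjacent (T : finType) : rel {set T} :=
  fun Phi Psi => (#|Phi :\: Psi| == 1%N) && (#|Psi :\: Phi| == 1%N).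

(* The rank of [F] is the length of the longest chains of faces below [F],
   normalised so that a least face has rank -1. *)
Definition face_rank (T : finType) (le : rel T) (P : {set T}) (F : T) : int :=
  ((\max_(C : {set T} | chain le [set G in P | le G F] C) #|C|)%N%:Z - 2)%R.

Definition faces_of_rank (T : finType) (le : rel T) (P : {set T}) (k : int) :
    {set T} :=
  [set F in P | face_rank le P F == k].

Definition has_extreme_faces (n : nat) (T : finType) (le : rel T)
    (P : {set T}) : Prop :=
  (exists2 F, F \in faces_of_rank le P (-1)%R & {in P, forall G, le F G}) /\
  (exists2 F, F \in faces_of_rank le P n%:Z & {in P, forall G, le G F}).

Definition diamond_condition (T : finType) (le : rel T) (P : {set T}) : Prop :=
  {in P &, forall F H, slt le F H ->
     (face_rank le P H - face_rank le P F = 2)%R ->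
     #|[set G in P | slt le F G && slt le G H]| = 2%N}.

Definition strongly_flag_connected (T : finType) (le : rel T) (P : {set T}) :
    Prop :=
  forall Phi Psi : {set T}, flag le P Phi -> flag le P Psi ->
    connect (fun X Y : {set T} =>
      [&& flag le P X, flag le P Y, adjacent X Y,
          Phi :&: Psi \subset X & Phi :&: Psi \subset Y]) Phi Psi.

Definition abstract_polytope (n : nat) (T : finType) (le : rel T)
    (P : {set T}) : Prop :=
  [/\ partial_order_on le P,
      has_extreme_faces n le P,
      forall Phi : {set T}, flag le P Phi -> #|Phi| = n.+2,
      diamond_condition le P
    & strongly_flag_connected le P].

(* A graph on [V] is a pair (vertices, edges), an edge being the set of its
   two endpoints. *)

Definition graph (V : finType) := ({set V} * {set {set V}})%type.

Definition subgraph_of (V : finType) : rel (graph V) :=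
  fun H K => (H.1 \subset K.1) && (H.2 \subset K.2).

Definition edge_subgraph (V : finType) (E : {set {set V}}) : graph V :=
  (cover E, E).

Definition component (V : finType) (H : graph V) (x : V) : graph V :=
  let W := [set y in H.1 | connect (fun u v => [set u; v] \in H.2) x y] in
  (W, [set e in H.2 | e \subset W]).

Definition components (V : finType) (H : graph V) : {set graph V} :=
  [set component H x | x in H.1].

(* The sign vector x stands for the point with coordinates (-1) ^+ x i. *)
Definition vertex := {ffun 'I_4 -> bool}.

Definition antipode (x : vertex) : vertex := [ffun i => ~~ x i].

Definition cube_edges_dir (i : 'I_4) : {set {set vertex}} :=
  [set [set x.1; x.2] | x : vertex * vertex
     & [forall j, (x.1 j != x.2 j) == (j == i)]].

Definition cube_edges : {set {set vertex}} := \bigcup_(i < 4) cube_edges_dir i.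

Definition cube_graph : graph vertex := ([set: vertex], cube_edges).

Definition qvertex (x : vertex) : {set vertex} := [set x; antipode x].

Definition qvertices : {set {set vertex}} := [set qvertex x | x : vertex].

(* The edge of the quotient that is the image of the edge [e]: the pair of
   antipodal edges containing [e]. *)
Definition qedge (e : {set vertex}) : {set {set vertex}} :=
  [set e; antipode @: e].

Definition qedges_dir (i : 'I_4) : {set {set {set vertex}}} :=
  [set qedge e | e in cube_edges_dir i].

Definition qedges : {set {set {set vertex}}} := [set qedge e | e in cube_edges].

Definition qends (E : {set {set vertex}}) : {set {set vertex}} :=
  [set qvertex x | x in cover E].

Definition perfect_matching (M : {set {set {set vertex}}}) : Prop :=
  [/\ M \subset qedges, #|M| = 4%N,
      {in M &, forall E E', E != E' -> [disjoint qends E & qends E']}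
    & \bigcup_(E in M) qends E = qvertices].

(* Only the values of a colouring on [qedges] are ever used. *)
Definition colouring := {set {set vertex}} -> 'I_4.

Definition chiral_colouring (c : colouring) : Prop :=
  forall a : 'I_4,
    perfect_matching [set E in qedges | c E == a] /\
    forall i : 'I_4, #|[set E in qedges_dir i | c E == a]| = 1%N.

Definition lift_colouring (c : colouring) (e : {set vertex}) : 'I_4 :=
  c (qedge e).

Definition colour_components (c : colouring) (m : nat) : {set graph vertex} :=
  \bigcup_(K : {set 'I_4} | #|K| == m)
    components (edge_subgraph [set e in cube_edges | lift_colouring c e \in K]).

Definition Qhat_rank (c : colouring) (k : int) : {set graph vertex} :=
  match k with
  | Negz 0 => [set (set0, set0)]
  | Posz 0 => [set ([set x], set0) | x : vertex]
  | Posz 1 => [set (e, [set e]) | e in cube_edges]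
  | Posz 2 => colour_components c 2
  | Posz 3 => colour_components c 3
  | Posz 4 => [set cube_graph]
  | _ => set0
  end.

(* The six ranks are i - 1 for i < 6. *)
Definition Qhat (c : colouring) : {set graph vertex} :=
  \bigcup_(i < 6) Qhat_rank c (i%:Z - 1)%R.

(* Imported only here: it shadows names of finset. *)
From mathcomp Require Import boolp classical_sets functions cardinality reals.

Local Open Scope card_scope.
Local Open Scope classical_set_scope.
Local Open Scope ring_scope.

(* The norm that the library puts on row vectors is the sup norm. *)
Definition edist (R : realType) (m : nat) (x y : 'rV[R]_m) : R :=
  Num.sqrt (\sum_(i < m) (x 0 i - y 0 i) ^+ 2).

Definition isometry (R : realType) (m : nat) (f : 'rV[R]_m -> 'rV[R]_m) : Prop :=
  forall x y, edist (f x) (f y) = edist x y.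

Definition segment (R : realType) (m : nat) (x y : 'rV[R]_m) : set 'rV[R]_m :=
  [set (1 - t) *: x + t *: y | t in [set t : R | 0 <= t <= 1]].

(* A graph in R^m: a set of points and a set of straight segments. *)
Definition geom_graph (R : realType) (m : nat) :=
  (set 'rV[R]_m * set (set 'rV[R]_m))%type.

Definition realise (R : realType) (m : nat) (V : finType) (pt : V -> 'rV[R]_m)
    (H : graph V) : geom_graph R m :=
  ([set pt x | x in [set` H.1]],
   [set s | exists x y : V,
      [set x; y]%SET \in H.2 /\ s = segment (pt x) (pt y)]).

Definition realise_set (R : realType) (m : nat) (V : finType)
    (pt : V -> 'rV[R]_m) (A : {set graph V}) : set (geom_graph R m) :=
  [set realise pt H | H in [set` A]].

Definition geom_image (R : realType) (m : nat) (f : 'rV[R]_m -> 'rV[R]_m)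
    (S : geom_graph R m) : geom_graph R m :=
  (f @` S.1, [set f @` s | s in S.2]).

Definition symmetry (R : realType) (m : nat) (V : finType)
    (pt : V -> 'rV[R]_m) (le : rel (graph V)) (P : {set graph V})
    (f : 'rV[R]_m -> 'rV[R]_m) : Prop :=
  isometry f /\
  forall k : int,
    geom_image f @` realise_set pt (faces_of_rank le P k) =
    realise_set pt (faces_of_rank le P k).

Definition flag_orbit (R : realType) (m : nat) (V : finType)
    (pt : V -> 'rV[R]_m) (le : rel (graph V)) (P : {set graph V})
    (Phi : {set graph V}) : set {set graph V} :=
  [set Psi | flag le P Psi /\
     exists2 f, symmetry pt le P f
              & geom_image f @` realise_set pt Phi = realise_set pt Psi].

Definition geometrically_chiral (R : realType) (m : nat) (V : finType)
    (pt : V -> 'rV[R]_m) (le : rel (graph V)) (P : {set graph V}) : Prop :=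
  [set flag_orbit pt le P Phi | Phi in [set Phi | flag le P Phi]] #= `I_2 /\
  forall Phi Psi : {set graph V}, flag le P Phi -> flag le P Psi ->
    adjacent Phi Psi -> flag_orbit pt le P Phi <> flag_orbit pt le P Psi.

(* Full rank: the dimension of the ambient space is the rank [n]. *)
Definition chiral_polytope_of_full_rank (R : realType) (n : nat) (V : finType)
    (pt : V -> 'rV[R]_n) (le : rel (graph V)) (P : {set graph V}) : Prop :=
  abstract_polytope n le P /\ geometrically_chiral pt le P.

Definition cube_pt (R : realType) (x : vertex) : 'rV[R]_4 :=
  \row_i (-1) ^+ x i.

Lemma range_cube_pt (R : realType) :
  range (@cube_pt R) = [set p | forall i, p 0 i = 1 \/ p 0 i = -1].
Proof.
apply/seteqP; split=> [_ [x _ <-] i|p hp].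
  by rewrite mxE; case: (x i); [right|left]; rewrite ?expr1 ?expr0.
exists [ffun i => p 0 i != 1] => //.
apply/rowP => i; rewrite mxE ffunE.
case: (hp i) => ->; first by rewrite eqxx.
suff -> : (-1 : R) != 1 by rewrite expr1.
by apply/eqP => ?; lra.
Qed.

Lemma cube_pt_antipode (R : realType) (x : vertex) :
  cube_pt R (antipode x) = - cube_pt R x.
Proof. by apply/rowP => i; rewrite !mxE ffunE signrN. Qed.

Lemma cube_pt_inj (R : realType) : injective (@cube_pt R).
Proof.
move=> x y exy; apply/ffunP => i.
by move/rowP/(_ i): exy; rewrite !mxE => /signr_inj.
Qed.

Lemma cube_pt_segment (R : realType) (x y z : vertex) :
  segment (cube_pt R x) (cube_pt R y) (cube_pt R z) -> z = x \/ z = y.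
Proof.
move=> [t /andP[t0 t1] E].
have {}E i : (1 - t) * (-1) ^+ x i + t * (-1) ^+ y i = (-1) ^+ z i :> R.
  by move/rowP/(_ i): E; rewrite !mxE.
have [t00|tn0] := eqVneq t 0.
  left; apply/ffunP => i; move: (E i); rewrite t00 subr0 mul1r mul0r addr0.
  by move/signr_inj.
have [t11|tn1] := eqVneq t 1.
  right; apply/ffunP => i; move: (E i); rewrite t11 subrr mul1r mul0r add0r.
  by move/signr_inj.
have {tn0}t0 : 0 < t by rewrite lt_neqAle eq_sym tn0.
have {tn1}t1 : t < 1 by rewrite lt_neqAle tn1.
left; apply/ffunP => i; move: (E i).
by case: (x i); case: (y i); case: (z i) => //=; rewrite ?expr1 ?expr0 => ?; lra.
Qed.

Lemma segment_endl (R : realType) m (p q : 'rV[R]_m) : segment p q p.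
Proof.
by exists 0; rewrite /= ?lexx ?ler01 // subr0 scale1r scale0r addr0.
Qed.

Lemma segment_endr (R : realType) m (p q : 'rV[R]_m) : segment p q q.
Proof.
by exists 1; rewrite /= ?lexx ?ler01 // subrr scale1r scale0r add0r.
Qed.

Lemma cube_segment_inj (R : realType) (x y u v : vertex) :
  segment (cube_pt R x) (cube_pt R y) = segment (cube_pt R u) (cube_pt R v) ->
  [set x; y]%SET = [set u; v]%SET.
Proof.
move=> E.
have Hx := segment_endl (cube_pt R x) (cube_pt R y).
have Hy := segment_endr (cube_pt R x) (cube_pt R y).
have Hu := segment_endl (cube_pt R u) (cube_pt R v).
have Hv := segment_endr (cube_pt R u) (cube_pt R v).
rewrite E in Hx Hy; rewrite -E in Hu Hv.
have mem x' y' z : segment (cube_pt R x') (cube_pt R y') (cube_pt R z) ->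
    z \in [set x'; y']%SET.
  by move=> /cube_pt_segment[] ->; rewrite !finset.inE eqxx ?orbT.
apply/eqP; rewrite finset.eqEsubset !finset.subUset !finset.sub1set.
by rewrite !mem.
Qed.

Lemma realise_cube_inj (R : realType) :
  {in [pred H : graph vertex | H.2 \subset cube_edges] &,
   injective (realise (@cube_pt R))}.
Proof.
have pairE (e : {set vertex}) : e \in cube_edges -> exists x y, e = [set x; y]%SET.
  by move=> /finset.bigcupP[i _ /imsetP[[x y] _ ->]]; exists x, y.
have sub (A B : {set {set vertex}}) : A \subset cube_edges ->
    [set s | exists x y : vertex, [set x; y]%SET \in A /\
       s = segment (cube_pt R x) (cube_pt R y)] `<=`
    [set s | exists x y : vertex, [set x; y]%SET \in B /\
       s = segment (cube_pt R x) (cube_pt R y)] -> A \subset B.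
  move=> /fintype.subsetP sA sAB; apply/fintype.subsetP => e eA.
  have [x [y exy]] := pairE e (sA e eA).
  have [|u [v [uvB /cube_segment_inj E]]] :=
    sAB (segment (cube_pt R x) (cube_pt R y)).
    by exists x, y; rewrite -exy.
  by rewrite exy E.
move=> [A1 A2] [B1 B2]; rewrite !inE /= => sA sB [E1 E2]; congr (_, _).
  apply/setP => x; apply/idP/idP => xA.
    have [y yB /cube_pt_inj <- //] : (@cube_pt R @` [set` B1]) (cube_pt R x).
    by rewrite -E1; exists x.
  have [y yB /cube_pt_inj <- //] : (@cube_pt R @` [set` A1]) (cube_pt R x).
  by rewrite E1; exists x.
apply/eqP; rewrite finset.eqEsubset; apply/andP; split.
  by apply: (sub _ _ sA) => s; rewrite E2.
by apply: (sub _ _ sB) => s; rewrite E2.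
Qed.

(* Main.v *)
Require Import Defs.
From mathcomp Require Import all_boot all_order all_algebra.
From mathcomp Require Import all_fingroup zify ring.
Set Implicit Arguments.
Unset Strict Implicit.
Unset Printing Implicit Defensive.

(** The chiral colouring enters only through two facts: at every vertex of the
  cube the four edges have different colours, and in every square of the cube
  the four edges have different colours.

  The first fact makes the cube a connected graph in which every colour acts on
  the vertices as a fixed-point free involution. The faces are then the orbits
  of the subgroups generated by sets of colours (with their edges), a flag is a
  vertex with an ordering of the colours, and the poset is a polytope: diamonds
  come from Boolean lattices, and strong flag-connectedness from sorting an
  ordering by adjacent transpositions and from moving along edges.

  By the second fact, the edge leaving the a-neighbour of x in the direction of
  the b-edge at x has one of the two remaining colours c and d. The flag
  (x; a, b, c, d) is called right- or left-handed accordingly. Passing to an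
  adjacent flag reverses its hand. A symmetry preserves the hand, because it
  respects adjacency of vertices. Conversely, the colouring can be reconstructed
  edge by edge from a flag and its hand, so the signed permutation that carries
  the vertex and the ordered edge directions of a flag to those of another flag
  with the same hand is a symmetry. So the hands are the two flag orbits. *)

(** * Graded posets *)

Section RankedPoset.

Variables (T : finType) (le : rel T) (P : {set T}) (rk : T -> nat) (bot : T).
Hypothesis poP : partial_order_on le P.
Hypothesis rk_lt : {in P &, forall F G, slt le F G -> rk F < rk G}.
Hypothesis botP : bot \in P.
Hypothesis bot_le : {in P, forall F, le bot F}.
Hypothesis rk_bot : rk bot = 0.
Hypothesis gapP : {in P &, forall F G, slt le F G -> (rk F).+1 < rk G ->
  exists2 H, H \in P & slt le F H && slt le H G}.

Let lexx : {in P, reflexive le}. Proof. by case: poP. Qed.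
Let le_trans : {in P & &, transitive le}. Proof. by case: poP. Qed.

Lemma chain_sub (C : {set T}) : chain le P C -> {subset C <= P}.
Proof. by case/andP => /subsetP. Qed.

Lemma chain_total (C : {set T}) : chain le P C -> {in C &, forall F G, le F G || le G F}.
Proof. by case/andP => _ /forall_inP h F G FC GC; move/forall_inP: (h F FC); apply. Qed.

Lemma chain_intro (C : {set T}) : {subset C <= P} ->
  {in C &, forall F G, le F G || le G F} -> chain le P C.
Proof.
move=> CP h; apply/andP; split; first exact/subsetP.
by apply/forall_inP => F FC; apply/forall_inP => G GC; apply: h.
Qed.

Lemma rk_le : {in P &, forall F G, le F G -> rk F <= rk G}.
Proof.
move=> F G FP GP h; case: (eqVneq F G) => [->//|ne].
by apply/ltnW/rk_lt => //; rewrite /slt ne.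
Qed.

Lemma chain_le (C : {set T}) F G : chain le P C -> F \in C -> G \in C ->
  rk F <= rk G -> le F G.
Proof.
move=> hC FC GC h; have sP := chain_sub hC.
case/orP: (chain_total hC FC GC) => // h'.
case: (eqVneq F G) => [->|ne]; first by rewrite lexx ?sP.
have := rk_lt (sP _ GC) (sP _ FC); rewrite /slt eq_sym ne h' => /(_ isT).
by rewrite ltnNge h.
Qed.

Lemma chain_rk_inj (C : {set T}) : chain le P C -> {in C &, injective rk}.
Proof.
move=> hC F G FC GC e; have sP := chain_sub hC.
case: poP => _ anti _; apply: anti; rewrite ?sP //.
by rewrite !(chain_le hC) // e.
Qed.

Lemma chainU1 (C : {set T}) F : chain le P C -> F \in P ->
  {in C, forall G, le F G || le G F} -> chain le P (F |: C).
Proof.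
move=> hC FP h; apply: chain_intro => [G|G H]; rewrite !inE.
  by case/predU1P => [->//|]; apply: chain_sub.
case/predU1P => [->|GC]; case/predU1P => [->|HC]; rewrite ?lexx ?h //.
  by rewrite orbC h.
exact: (chain_total hC).
Qed.

Lemma flag_comparable (C : {set T}) F : flag le P C -> F \in P ->
  {in C, forall G, le F G || le G F} -> F \in C.
Proof.
move=> /maxsetP[hC maxC] FP h.
by rewrite -(maxC _ (chainU1 hC FP h)) ?subsetUr // setU11.
Qed.

Section Full.
Variables (top : T).
Hypotheses (topP : top \in P) (le_top : {in P, forall F, le F top}).

(** In the flag, take [G] highest of rank at most [r] and [H] lowest of rank above [r]. If
    [rk G < r], a face strictly between them is comparable with the whole flag, hence belongs to it,
    against the choice of [G] or [H]. *)
Lemma flag_rank_ex (C : {set T}) r : flag le P C -> r <= rk top ->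
  exists2 F, F \in C & rk F = r.
Proof.
move=> hC rtop; have /maxsetP[cC _] := hC; have sP := chain_sub cC.
have botC : bot \in C by apply: flag_comparable => // G /sP /bot_le ->.
have topC : top \in C by apply: flag_comparable => // G /sP /le_top ->; rewrite orbT.
case: (@arg_maxnP _ bot (fun F => (F \in C) && (rk F <= r)) rk).
  by rewrite botC rk_bot.
move=> G /andP[GC Gr] maxG.
have [|rG] := eqVneq (rk G) r; first by exists G.
have [<-|rtop'] := eqVneq (rk top) r; first by exists top.
case: (@arg_minnP _ top (fun F => (F \in C) && (r < rk F)) rk).
  by rewrite topC ltn_neqAle eq_sym rtop'.
move=> H /andP[HC Hr] minH.
have GH : rk G < rk H by apply: leq_ltn_trans Gr Hr.
have sGH : slt le G H.
  rewrite /slt (chain_le cC) // ?(ltnW GH) // andbT.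
  by apply: contraTneq GH => ->; rewrite ltnn.
have [|M MP /andP[GM MH]] := gapP (sP _ GC) (sP _ HC) sGH.
  by apply: leq_trans Hr; rewrite ltnS ltn_neqAle rG.
have MC : M \in C.
  apply: flag_comparable => // X XC.
  case: (leqP (rk X) r) => Xr.
    apply/orP; right; apply: (@le_trans G) => //; rewrite ?sP //; last by case/andP: GM.
    by apply: (chain_le cC) => //; apply: maxG; rewrite XC.
  apply/orP; left; apply: (@le_trans H) => //; rewrite ?sP //; first by case/andP: MH.
  by apply: (chain_le cC) => //; apply: minH; rewrite XC.
have GM' := rk_lt (sP _ GC) MP GM; have MH' := rk_lt MP (sP _ HC) MH.
case: (leqP (rk M) r) => Mr.
  by have := maxG M; rewrite MC Mr => /(_ isT); rewrite /= leqNgt GM'.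
by have := minH M; rewrite MC Mr => /(_ isT); rewrite /= leqNgt MH'.
Qed.

(** The rank is a bijection from the flag onto the numbers from 0 to [rk top]. *)
Lemma card_flag (C : {set T}) : flag le P C -> #|C| = (rk top).+1.
Proof.
move=> hC; have /maxsetP[cC _] := hC; have sP := chain_sub cC.
have rC F : F \in C -> rk F < (rk top).+1.
  by move=> FC; have FP := sP _ FC; rewrite ltnS; apply: rk_le => //; apply: le_top.
pose f F : 'I_(rk top).+1 := inord (rk F).
have fE F : F \in C -> f F = rk F :> nat by move=> FC; rewrite inordK ?rC.
rewrite -(@card_in_imset _ _ f) => [|F G FC GC /(congr1 val)]; last first.
  by rewrite /= !fE // => /(chain_rk_inj cC); apply.
rewrite -[RHS]card_ord -cardsT; congr #|pred_of_set _|; apply/setP => r.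
rewrite inE; have [|F FC Fr] := @flag_rank_ex C r hC; first by rewrite -ltnS.
by apply/imsetP; exists F => //; apply: val_inj; rewrite /= fE.
Qed.

Lemma card_chain (C : {set T}) : chain le P C ->
  #|C| <= (rk top).+1 ?= iff flag le P C.
Proof.
move=> cC; have [D hD sCD] := maxset_exists cC.
rewrite -(card_flag hD); have [le1 eq1] := subset_leqif_card sCD; split => //; rewrite eq1.
apply/idP/idP => [sDC|hC].
  suff <- : D = C by []; by apply/eqP; rewrite eqEsubset sDC.
by have /maxsetP[_ h] := hC; rewrite (h D) //; case/maxsetP: hD.
Qed.

Lemma max_card_chain :
  \max_(C : {set T} | chain le P C) #|C| = (rk top).+1.
Proof.
apply/eqP; rewrite eqn_leq; apply/andP; split.
  by apply/bigmax_leqP => C cC; apply: (card_chain cC).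
have c0 : chain le P set0 by apply: chain_intro => [F|F G]; rewrite inE.
have [D hD _] := maxset_exists c0; rewrite -(card_flag hD).
by apply: leq_bigmax_cond; case/maxsetP: hD.
Qed.

End Full.
End RankedPoset.

(** The faces below [F] form a poset with greatest face [F], whose longest chains have [rk F + 1]
    elements; [face_rank] subtracts 2. *)
Lemma face_rankE (T : finType) (le : rel T) (P : {set T}) (rk : T -> nat)
    (bot : T) :
  partial_order_on le P -> {in P &, forall F G, slt le F G -> rk F < rk G} ->
  bot \in P -> {in P, forall F, le bot F} -> rk bot = 0 ->
  {in P &, forall F G, slt le F G -> (rk F).+1 < rk G ->
     exists2 H, H \in P & slt le F H && slt le H G} ->
  {in P, forall F, face_rank le P F = ((rk F)%:Z - 1)%R}.
Proof.
move=> [r a t] rlt bP bl rb gap F FP; rewrite /face_rank.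
have sP G : G \in [set G in P | le G F] -> G \in P by rewrite inE => /andP[].
rewrite (@max_card_chain _ le _ rk bot _ _ _ _ _ _ F) //.
- split=> [G /sP/r//|G H /sP GP /sP HP|G H K /sP GP /sP HP /sP KP].
    exact: a.
  exact: t.
- by move=> G H /sP GP /sP HP; apply: rlt.
- by rewrite inE bP bl.
- by move=> G /sP; apply: bl.
- move=> G H; rewrite !inE => /andP[GP GF] /andP[HP HF] GH gp.
  have [M MP /andP[GM MH]] := gap _ _ GP HP GH gp; exists M; last by rewrite GM.
  by rewrite inE MP (t H) //; case/andP: MH.
- by rewrite inE FP r.
- by move=> G; rewrite inE => /andP[].
Qed.

(** * Adjacent transpositions *)

Section AdjacentTranspositions.

Variable n : nat.
Implicit Types (s t u : 'S_n) (i j k : 'I_n).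

(** Increase gives [i <= u i]; both sides have the same sum since [u] permutes the indices, so
    equality holds throughout. *)
Lemma perm_increasing u :
  (forall i j, j = i.+1 :> nat -> u i < u j) -> u = 1%g.
Proof.
move=> u_lt.
have le_u i : i <= u i.
  case: i => m; elim: m => // m IH lt_m.
  by apply: leq_ltn_trans (IH (ltnW lt_m)) _; apply: u_lt.
have [_ /esym] := leqif_sum (fun i (_ : xpredT i) => leqif_eq (le_u i)).
have -> : \sum_i (u i : nat) = \sum_(i < n) i.
  by rewrite [RHS](reindex_inj (@perm_inj _ u)).
rewrite eqxx => /forallP u_id; apply/permP => i; rewrite perm1.
by apply/val_inj/esym/eqP; apply: u_id.
Qed.

(** Bubble sort as an induction principle: [s] is brought to [t] by swapping neighbouring entries
    that [t] has in the opposite order. The product [tperm i j * s] swaps the entries in positions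
    [i] and [j]. *)
Lemma perm_sort_ind t (Q : 'S_n -> Prop) : Q t ->
  (forall s i j, j = i.+1 :> nat -> (t^-1 (s j) < t^-1 (s i))%g ->
     Q (tperm i j * s)%g -> Q s) ->
  forall s, Q s.
Proof.
move=> Qt Qstep s.
(* Swapping an adjacent inversion increases this weight. *)
pose w s := \sum_(i < n) i * (s * t^-1)%g i.
have w_le s' : w s' <= n * (n * n).
  rewrite -[n in n * _]card_ord -sum_nat_const; apply: leq_sum => i _.
  by apply: leq_mul; apply: ltnW.
have [m] := ubnP (n * (n * n) - w s); elim: m s => // m IH s lt_m.
have [[i j] /= /andP[/eqP ji desc]|asc] :=
    pickP (fun p : 'I_n * 'I_n => (p.2 == p.1.+1 :> nat) &&
             ((t^-1)%g (s p.2) < (t^-1)%g (s p.1))).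
  apply: (Qstep s i j) => //; apply: IH.
  suff: w s < w (tperm i j * s)%g by have := w_le (tperm i j * s)%g; lia.
  have ij : j != i by apply/eqP => /(congr1 val) /=; lia.
  rewrite /w (bigD1 i) // (bigD1 j) //= [X in _ < X](bigD1 i) // (bigD1 j) //=.
  set S1 := \sum_(k < n | _) _; set S2 := \sum_(k < n | _) _.
  have -> : S2 = S1.
    by apply: eq_bigr => k /andP[ki kj]; rewrite !permM tpermD // eq_sym.
  rewrite !permM tpermL tpermR; move: desc; rewrite ji.
  by set x := (t^-1)%g _; set y := (t^-1)%g _; clearbody S1; nia.
suff /eqP : (s * t^-1)%g = 1%g by rewrite -eq_mulgV1 => /eqP ->.
apply: perm_increasing => i j ji; rewrite !permM.
have := asc (i, j); rewrite /= ji eqxx /= => /negbT; rewrite -leqNgt.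
rewrite leq_eqVlt => /orP[/eqP/val_inj/perm_inj/perm_inj ij|//].
by move: ji; rewrite ij; lia.
Qed.

(** An ordering [s] lists [s 0, s 1, ...], so [s^-1 a] is the position of [a], and this is a prefix
    taken as a set. *)
Definition pre s (m : nat) : {set 'I_n} := [set a | (s^-1)%g a < m].

Lemma mem_pre s m i : (s i \in pre s m) = (i < m).
Proof. by rewrite inE permK. Qed.

Lemma card_pre s m : m <= n -> #|pre s m| = m.
Proof.
move=> mn; pose f (k : 'I_m) := s (widen_ord mn k).
have f_inj : injective f by move=> k l /perm_inj /(congr1 val) /= /val_inj.
rewrite -[RHS]card_ord -(card_codom f_inj); apply: eq_card => a.
rewrite inE; apply/idP/codomP => [lt_m|[k ->]]; last by rewrite permK /=.
by exists (Ordinal lt_m); rewrite -[LHS](permKV s); congr (s _); apply: val_inj.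
Qed.

Lemma pre0 s : pre s 0 = set0.
Proof. by apply/setP => a; rewrite !inE. Qed.

Lemma preT s m : n <= m -> pre s m = setT.
Proof. by move=> nm; apply/setP => a; rewrite !inE (leq_trans _ nm). Qed.

Lemma sub_pre s m m' : m <= m' -> pre s m \subset pre s m'.
Proof. by move=> mm; apply/subsetP => a; rewrite !inE => /leq_trans; apply. Qed.

Lemma pre_tperm s i j m : (i < m) = (j < m) ->
  pre (tperm i j * s) m = pre s m.
Proof.
move=> ijm; apply/setP => a; rewrite !inE invMg permM tpermV.
by case: tpermP => // ->.
Qed.

Lemma pre_tperm_succ s i j (m : nat) : j = i.+1 :> nat -> m != j ->
  pre (tperm i j * s) m = pre s m.
Proof. by move=> ji /eqP mj; apply: pre_tperm; apply/idP/idP; lia. Qed.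

(** The prefix of [s] of length [j] contains [s i] but not [s j], while a prefix of [t] containing
    [s i] contains [s j]. Hence sorting towards [t] only changes prefixes not shared with [t]. *)
Lemma pre_descent s t i j : j = i.+1 :> nat ->
  (t^-1 (s j) < t^-1 (s i))%g -> pre s j != pre t j.
Proof.
move=> ji desc; apply/eqP => e.
have := mem_pre s j i; have := mem_pre s j j; rewrite e !inE; lia.
Qed.

Lemma pre_inj s t : (forall m, pre s m = pre t m) -> s = t.
Proof.
move=> e; move: s e; apply: (@perm_sort_ind t) => // s i j ji desc _ e.
by case/eqP: (pre_descent ji desc).
Qed.

(** A sorting step must act on the prefix of length [m]. If it did not already give [t], then by
    induction the same swap once more would, and [s] would equal [t]. *)
Lemma pre_eq_but s t (m : nat) : (forall m', m' != m -> pre s m' = pre t m') -> s != t ->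
  exists i j, [/\ j = i.+1 :> nat, m = j & t = (tperm i j * s)%g].
Proof.
move: s.
pose Q s := (forall m', m' != m -> pre s m' = pre t m') -> s != t ->
  exists i j, [/\ j = i.+1 :> nat, m = j & t = (tperm i j * s)%g].
apply: (@perm_sort_ind t Q) => [_|s i j ji desc IH e st]; first by rewrite eqxx.
have mj : m = j.
  by apply/eqP; apply: contraT; rewrite eq_sym => /e ej; have := pre_descent ji desc; rewrite ej eqxx.
exists i, j; split => //; apply/esym/eqP; apply: contraT => ne.
have [m' ne'|i' [j' [ji' mj' te]]] := IH _ ne.
  by rewrite (pre_tperm_succ _ ji) ?e -?mj.
have jj : j' = j by apply: val_inj; rewrite /= -mj' mj.
have ii : i' = i by apply: val_inj; move: ji' ji; rewrite jj /=; lia.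
by move: st; rewrite te ii jj mulgA tperm2 mul1g eqxx.
Qed.

End AdjacentTranspositions.

(** * Polytopes from properly coloured graphs *)

Section ColourfulPolytope.

(** [nb a x] is the other end of the edge of colour [a] at [x]; [x0] serves as base point of the
    greatest face. *)
Variables (n : nat) (V : finType) (nb : 'I_n -> V -> V) (x0 : V).
Implicit Types (x y z : V) (a b : 'I_n) (K L : {set 'I_n}) (s t : 'S_n).
Implicit Types (F G H : graph V).

Definition orb K x : {set V} :=
  [set y | connect (fun u v => [exists a in K, v == nb a u]) x y].

Definition face x K : graph V :=
  (orb K x, [set [set z; nb a z] | z in orb K x, a in K]).

Definition face0 : graph V := (set0, set0).

Definition faces : {set graph V} :=
  face0 |: [set face x K | x : V, K : {set 'I_n}].

Hypothesis nbK : forall a, involutive (nb a).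
Hypothesis nb_inj : forall x, injective (nb^~ x).
Hypothesis nb_neq : forall a x, nb a x != x.
Hypothesis nb_conn : forall x, orb setT x = setT.

(** * Orbits of sets of colours *)

Lemma orb_refl K x : x \in orb K x. Proof. by rewrite inE. Qed.

Lemma orb_step K x y a : y \in orb K x -> a \in K -> nb a y \in orb K x.
Proof.
rewrite !inE => xy aK; apply: connect_trans xy (connect1 _).
by apply/exists_inP; exists a.
Qed.

Lemma orb_ind K x (Q : V -> Prop) : Q x ->
  (forall y a, y \in orb K x -> a \in K -> Q y -> Q (nb a y)) ->
  forall y, y \in orb K x -> Q y.
Proof.
move=> Qx Qs y; rewrite inE => /connectP[p]; elim/last_ind: p y => [|p z IH] y.
  by move=> _ ->.
rewrite rcons_path last_rcons => /andP[pth /exists_inP[a aK /eqP e]] ->.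
rewrite e; apply: Qs => //; last by apply: IH.
by rewrite inE; apply/connectP; exists p.
Qed.

Lemma orb_trans K x y z : y \in orb K x -> z \in orb K y -> z \in orb K x.
Proof. by rewrite !inE; apply: connect_trans. Qed.

Lemma orb_sym K x y : (x \in orb K y) = (y \in orb K x).
Proof.
suff h u v : u \in orb K v -> v \in orb K u by apply/idP/idP; apply: h.
apply: (@orb_ind K v (fun u => v \in orb K u)) => {u} [|u a uv aK vu].
  exact: orb_refl.
by apply: orb_trans vu; rewrite -{1}(nbK a u) orb_step ?orb_refl.
Qed.

Lemma orb_eq K x y : y \in orb K x -> orb K y = orb K x.
Proof.
move=> yx; apply/setP => z; apply/idP/idP; first exact: orb_trans.
by apply: orb_trans; rewrite orb_sym.
Qed.

Lemma orb_sub K L x y : K \subset L -> x \in orb L y ->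
  orb K x \subset orb L y.
Proof.
move=> /subsetP KL xy; apply/subsetP; apply: orb_ind => // z a _ /KL.
by move=> aL zy; apply: orb_step.
Qed.

Lemma orb0 x : orb set0 x = [set x].
Proof.
apply/setP => y; rewrite in_set1; apply/idP/eqP => [|->]; last exact: orb_refl.
by apply: (@orb_ind set0 x (fun y => y = x)) => // z a _; rewrite in_set0.
Qed.

Lemma orb1 a x : orb [set a] x = [set x; nb a x].
Proof.
apply/setP => y; apply/idP/set2P => [|[]->]; last 2 first.
- exact: orb_refl.
- by rewrite orb_step ?orb_refl ?set11.
apply: (@orb_ind _ x (fun y => y = x \/ y = nb a x)); first by left.
by move=> z b _ /set1P->[]->; [right|left; rewrite nbK].
Qed.

(** Neighbours of a vertex along different colours differ, whichever end the edge is read from. Thus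
    the colour set of a face can be recovered from its edges. *)
Lemma edge_colour a b x y : [set x; nb a x] = [set y; nb b y] -> a = b.
Proof.
move=> e; have : x \in [set y; nb b y] by rewrite -e set21.
have : nb a x \in [set y; nb b y] by rewrite -e set22.
case/set2P => e1 /set2P[] e2; apply: (@nb_inj x).
- by have := nb_neq a x; rewrite e1 e2 eqxx.
- by rewrite e1 e2 nbK.
- by rewrite e1 e2.
- by have := nb_neq a x; rewrite e1 -e2 eqxx.
Qed.

Lemma face_edge x K z a :
  ([set z; nb a z] \in (face x K).2) = (z \in orb K x) && (a \in K).
Proof.
apply/imset2P/andP => [[w b wK bK e]|[zx aK]]; last by exists z a.
have ab := edge_colour e; rewrite ab; split=> //.
have : z \in [set w; nb b w] by rewrite -e set21.
by case/set2P => ->; rewrite ?orb_step.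
Qed.

(** The edges at [x] reveal the colours of the smaller face. Through this equivalence, questions of
    order become questions about subsets of colours and a common vertex. *)
Lemma face_sub x K y L :
  subgraph_of (face x K) (face y L) = (K \subset L) && (x \in orb L y).
Proof.
apply/idP/andP => [/andP[/= /subsetP sV /subsetP sE]|[KL xy]].
  split; last by apply/sV/orb_refl.
  apply/subsetP => a aK; have := sE [set x; nb a x]; rewrite !face_edge aK orb_refl.
  by move=> /(_ isT)/andP[].
have sO := orb_sub KL xy; apply/andP; split => //=.
apply/subsetP => _ /imset2P[z a zx aK ->]; apply: imset2_f.
  exact: (subsetP sO).
exact: (subsetP KL).
Qed.

Lemma face_base x y K : y \in orb K x -> face y K = face x K.
Proof. by move=> yx; rewrite /face (orb_eq yx). Qed.

Lemma face_inj x K y L : face x K = face y L -> K = L /\ x \in orb L y.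
Proof.
move=> e; have : subgraph_of (face x K) (face y L) by rewrite e face_sub subxx orb_refl.
have : subgraph_of (face y L) (face x K) by rewrite e face_sub subxx orb_refl.
rewrite !face_sub => /andP[LK _] /andP[KL ->]; split => //.
by apply/eqP; rewrite eqEsubset KL.
Qed.

Lemma face0_sub F : subgraph_of face0 F.
Proof. by rewrite /subgraph_of !sub0set. Qed.

Lemma sub_face0 x K : subgraph_of (face x K) face0 = false.
Proof.
apply/negbTE/negP => /andP[/subsetP/(_ x (orb_refl K x))]; by rewrite inE.
Qed.

Lemma face_neq0 x K : face x K != face0.
Proof.
apply: contraFneq (sub_face0 x K) => {1}->; exact: face0_sub.
Qed.

Lemma facesP F : reflect (F = face0 \/ exists x K, F = face x K) (F \in faces).
Proof.
apply: (iffP setU1P) => -[->|]; try by left.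
  by case/imset2P => x K _ _ ->; right; exists x, K.
by case=> x [K ->]; right; apply: imset2_f.
Qed.

Lemma face0_in : face0 \in faces. Proof. exact: setU11. Qed.

Lemma face_in x K : face x K \in faces.
Proof. by apply/facesP; right; exists x, K. Qed.

Definition colours F : {set 'I_n} :=
  [set a | [exists x, [set x; nb a x] \in F.2]].

Lemma coloursE x K : colours (face x K) = K.
Proof.
apply/setP => a; rewrite inE; apply/existsP/idP => [[z]|aK].
  by rewrite face_edge => /andP[].
by exists x; rewrite face_edge orb_refl.
Qed.

(* One more than the rank, so that it is a natural number. *)
Definition grade F : nat := if F == face0 then 0 else #|colours F|.+1.

Lemma grade0 : grade face0 = 0. Proof. by rewrite /grade eqxx. Qed.

Lemma grade_face x K : grade (face x K) = #|K|.+1.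
Proof. by rewrite /grade (negbTE (face_neq0 x K)) coloursE. Qed.

(** * Order, ranks and diamonds of the face poset *)

Let le := @subgraph_of V.

Lemma faces_po : partial_order_on le faces.
Proof.
split=> [F _|[F1 F2] [G1 G2] _ _|F G H _ _ _].
- by rewrite /le /subgraph_of !subxx.
- move=> /andP[/andP[/= a1 a2] /andP[/= b1 b2]].
  by congr (_, _); apply/eqP; rewrite eqEsubset ?a1 ?a2.
move=> /andP[h1 h2] /andP[h3 h4]; apply/andP; split.
  exact: subset_trans h1 h3.
exact: subset_trans h2 h4.
Qed.

Lemma slt_face0 x K : slt le face0 (face x K).
Proof. by rewrite /slt /le eq_sym face_neq0 face0_sub. Qed.

Lemma slt_face0r F : F \in faces -> slt le F face0 = false.
Proof.
move=> /facesP[->|[x [K ->]]]; rewrite /slt ?eqxx //.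
by rewrite /le sub_face0 andbF.
Qed.

Lemma slt_face x K y L :
  slt le (face x K) (face y L) = (K \proper L) && (x \in orb L y).
Proof.
rewrite /slt /le face_sub andbA; case xy: (x \in _); rewrite ?andbF // !andbT.
rewrite -(face_base xy) properE andbC; case: (boolP (K \subset L)) => //= KL.
congr (~~ _); apply/eqP/idP => [/face_inj[-> _] //|LK].
by congr face; apply/eqP; rewrite eqEsubset KL.
Qed.

Lemma grade_lt : {in faces &, forall F G, slt le F G -> grade F < grade G}.
Proof.
move=> F G Fin /facesP[->|[y [L ->]]]; first by rewrite slt_face0r.
case/facesP: Fin => [->|[x [K ->]]]; first by rewrite grade0 grade_face.
by rewrite slt_face !grade_face => /andP[/proper_card].
Qed.

(** Above the empty face, insert a vertex; above a face with colours [K], add to [K] one missing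
    colour of the larger face. *)
Lemma grade_gap : {in faces &, forall F G, slt le F G -> (grade F).+1 < grade G ->
  exists2 H, H \in faces & slt le F H && slt le H G}.
Proof.
move=> F G Fin /facesP[->|[y [L ->]]]; first by rewrite slt_face0r.
case/facesP: Fin => [->|[x [K ->]]].
  rewrite grade0 grade_face ltnS card_gt0 => _ L0.
  exists (face y set0); rewrite ?face_in // slt_face0 slt_face proper0 L0.
  exact: orb_refl.
rewrite slt_face !grade_face !ltnS => /andP[KL xy] cK.
have /properP[sKL [a aL aK]] := KL.
exists (face x (a |: K)); first exact: face_in.
have aKL : a |: K \proper L.
  by rewrite properEcard subUset sub1set aL sKL cardsU1 aK.
by rewrite !slt_face properUr ?sub1set // orb_refl aKL xy.
Qed.

Lemma le_top F : F \in faces -> le F (face x0 setT).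
Proof.
case/facesP => [->|[x [K ->]]]; first exact: face0_sub.
by rewrite /le face_sub subsetT nb_conn inE.
Qed.

Lemma face0_le F : F \in faces -> le face0 F.
Proof. by move=> _; apply: face0_sub. Qed.

Lemma face_rank_grade F : F \in faces ->
  face_rank le faces F = ((grade F)%:Z - 1)%R.
Proof.
apply: (face_rankE faces_po grade_lt face0_in face0_le grade0 grade_gap).
Qed.

Lemma face_rank_face x K : face_rank le faces (face x K) = Posz #|K|.
Proof. by rewrite face_rank_grade ?face_in // grade_face; lia. Qed.

Lemma face_rank_face0 : face_rank le faces face0 = (-1)%R.
Proof. by rewrite face_rank_grade ?face0_in // grade0. Qed.

Lemma faces_extreme : has_extreme_faces n le faces.
Proof.
split.
  exists face0; last exact: face0_le.
  by rewrite inE face0_in face_rank_face0 eqxx.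
exists (face x0 setT); last exact: le_top.
by rewrite inE face_in face_rank_face cardsT card_ord eqxx.
Qed.

(** Below an edge lie its two ends. Otherwise [L] has exactly two colours outside [K], and the
    intermediate faces arise by adding one of them to [K], with base [y]. *)
Lemma faces_diamond : diamond_condition le faces.
Proof.
move=> F G Fin /facesP[->|[x [L ->]]]; first by rewrite slt_face0r.
case/facesP: Fin => [->|[y [K ->]]].
  rewrite face_rank_face face_rank_face0 => _ cL.
  have /cards1P[a La] : #|L| == 1 by apply/eqP; lia.
  transitivity #|[set face x set0; face (nb a x) set0]|.
    apply: eq_card => M; rewrite in_set2 inE.
    apply/andP/orP => [[/facesP[->|[z [K ->]]]]|]; first by rewrite slt_face0r ?face0_in.
      rewrite slt_face La => /andP[_ /andP[/proper_card]].
      rewrite cards1 ltnS leqn0 cards_eq0 => /eqP-> ; rewrite orb1.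
      by case/set2P => ->; [left|right].
    have xL : x \in orb L x by apply: orb_refl.
    have aL : nb a x \in orb L x by rewrite La orb_step ?orb_refl ?set11.
    have L0 : set0 \proper L by rewrite proper0 La; apply/set0Pn; exists a; apply: set11.
    by case=> /eqP->; rewrite face_in slt_face0 slt_face L0.
  rewrite cards2; case: eqP => // /face_inj[_]; rewrite orb0 => /set1P e.
  by have := nb_neq a x; rewrite -e eqxx.
rewrite slt_face => /andP[KL yx]; rewrite -(face_base yx) !face_rank_face => cL.
have {}cL : #|L| = #|K|.+2 by move: cL; clear; lia.
have KL' := proper_sub KL.
have cD : #|L :\: K| = 2 by rewrite cardsD (setIidPr KL') cL -addn2 addKn.
have /cards2P[a [b [ab De]]] : #|L :\: K| == 2 by rewrite cD.
have : a \in L :\: K by rewrite De set21.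
have : b \in L :\: K by rewrite De set22.
rewrite !inE => /andP[bK bL] /andP[aK aL].
transitivity #|[set face y (a |: K); face y (b |: K)]|.
  apply: eq_card => M; rewrite in_set2 inE.
  have pr c : c \notin K -> c \in L -> face y (c |: K) \in faces /\
      slt le (face y K) (face y (c |: K)) && slt le (face y (c |: K)) (face y L).
    move=> cK cL'; split; first exact: face_in.
    rewrite !slt_face !orb_refl !andbT properUr ?sub1set //=.
    by rewrite properEcard subUset sub1set cL' KL' cardsU1 cK cL /= add1n ltnSn.
  apply/andP/orP => [[/facesP[->|[z [M' ->]]]]|].
  - by rewrite slt_face0r ?face_in.
  - rewrite !slt_face => /andP[/andP[KM yz] /andP[ML zy]].
    rewrite (face_base (y := z) (x := y)) ?(orb_sym _ z) //.
    have /properP[sKM [c cM cK]] := KM.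
    have -> : M' = c |: K.
      apply/esym/eqP; rewrite eqEcard subUset sub1set cM sKM cardsU1 cK /=.
      by rewrite -ltnS -cL proper_card.
    have : c \in L :\: K by rewrite inE cK (subsetP (proper_sub ML)).
    by rewrite De => /set2P[]->; [left|right].
  - by case=> /eqP->; apply: pr.
rewrite cards2; case: eqP => // /face_inj[e _].
have : a \in b |: K by rewrite -e setU11.
by rewrite !inE (negbTE ab) (negbTE aK).
Qed.

(** * Flags as vertices with orderings of the colours *)

Lemma grade_top : grade (face x0 setT) = n.+1.
Proof. by rewrite grade_face cardsT card_ord. Qed.

Lemma card_flag_faces (Phi : {set graph V}) : flag le faces Phi -> #|Phi| = n.+2.
Proof.
move=> hPhi; rewrite -grade_top.
exact: (card_flag faces_po grade_lt face0_in face0_le grade0 grade_gap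
  (face_in _ _) le_top).
Qed.

(** Prefix lengths run from 0, which gives the vertex [x], to [n], which gives the whole graph. *)
Definition flag_of x s : {set graph V} :=
  face0 |: [set face x (pre s j) | j : 'I_n.+1].

Lemma mem_flag_of x s y K :
  (face y K \in flag_of x s) = (K == pre s #|K|) && (x \in orb K y).
Proof.
rewrite in_setU1 (negbTE (face_neq0 _ _)) /=; apply/imsetP/andP => [[j _ e]|[/eqP e xy]].
  have [-> yx] := face_inj e; rewrite card_pre ?eqxx; last by rewrite -ltnS.
  by rewrite orb_sym yx.
have cK : #|K| < n.+1 by rewrite ltnS -[n in _ <= n]card_ord max_card.
by exists (Ordinal cK); rewrite //= -e (face_base xy).
Qed.

Lemma face0_flag_of x s : face0 \in flag_of x s. Proof. exact: setU11. Qed.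

Lemma flag_of_sub x s : {subset flag_of x s <= faces}.
Proof.
move=> F /setU1P[->|/imsetP[j _ ->]]; [exact: face0_in|exact: face_in].
Qed.

Lemma flag_ofP x s F :
  reflect (F = face0 \/ exists2 m, m <= n & F = face x (pre s m))
          (F \in flag_of x s).
Proof.
apply: (iffP setU1P) => -[->|]; try by left.
  by case/imsetP => j _ ->; right; exists j; rewrite // -ltnS.
by case=> m mn ->; right; apply/imsetP; exists (inord m); rewrite ?inordK.
Qed.

(** Maximality follows by counting: the chain attains the bound of [card_chain]. *)
Lemma flag_of_flag x s : flag le faces (flag_of x s).
Proof.
have ch : chain le faces (flag_of x s).
  apply: chain_intro => [F|F G]; first exact: flag_of_sub.
  case/flag_ofP => [->|[m mn ->]]; first by rewrite /le face0_sub.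
  case/flag_ofP => [->|[m' mn' ->]]; first by rewrite orbC /le face0_sub.
  rewrite /le !face_sub !orb_refl !andbT.
  by case/orP: (leq_total m m') => /(sub_pre s)->; rewrite ?orbT.
rewrite -(card_chain faces_po grade_lt face0_in face0_le grade0 grade_gap
  (face_in _ _) le_top ch) grade_top cardsU1.
rewrite card_in_imset => [|i j _ _ /face_inj[e _]].
  rewrite card_ord; case: imsetP => // -[j _ /eqP].
  by rewrite eq_sym (negbTE (face_neq0 _ _)).
by apply: val_inj; rewrite /= -(@card_pre n s i) -1?ltnS // e card_pre -1?ltnS.
Qed.

(** The vertex of the flag lies in all its nonempty faces, so these can be based at it. Their colour
    sets grow one colour at a time, and the colour gained at each step defines the ordering. *)
Lemma flagE (Phi : {set graph V}) : flag le faces Phi ->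
  exists x s, Phi = flag_of x s.
Proof.
move=> hPhi; have /maxsetP[cPhi maxPhi] := hPhi; have sP := chain_sub cPhi.
have ex m : m <= n -> exists2 F, F \in Phi & grade F = m.+1.
  move=> mn; apply: (flag_rank_ex faces_po grade_lt face0_in face0_le grade0
    grade_gap (face_in _ _) le_top hPhi).
  by rewrite grade_top ltnS.
have [F FPhi F1] := ex 0 isT.
case/facesP: (sP _ FPhi) => [F0|[x [K0 FE]]]; first by rewrite F0 grade0 in F1.
have {F1} K00 : K0 = set0.
  by apply/eqP; rewrite -cards_eq0; move: F1; rewrite FE grade_face => -[->].
have {ex} ex (m : 'I_n.+1) : exists K, (face x K \in Phi) && (#|K| == m).
  have [|G GPhi gG] := ex m; first by rewrite -ltnS.
  case/facesP: (sP _ GPhi) => [G0|[y [K GE]]]; first by rewrite G0 grade0 in gG.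
  move: gG; rewrite GE grade_face => -[cK].
  exists K; rewrite cK eqxx andbT; suff: le F G.
    rewrite FE GE /le face_sub => /andP[_ xy]; rewrite (face_base xy) -GE //.
  by apply: (chain_le faces_po grade_lt cPhi) => //; rewrite FE GE !grade_face K00 cards0.
pose kk (m : nat) := xchoose (ex (inord m)).
have kP m : m <= n -> face x (kk m) \in Phi by move=> mn; case/andP: (xchooseP (ex (inord m))).
have kC m : m <= n -> #|kk m| = m.
  move=> mn; case/andP: (xchooseP (ex (inord m))) => _ /eqP e.
  by rewrite /kk e inordK.
have kS m m' : m <= m' -> m' <= n -> kk m \subset kk m'.
  move=> mm mn; suff: le (face x (kk m)) (face x (kk m')).
    by rewrite /le face_sub => /andP[].
  apply: (chain_le faces_po grade_lt cPhi); rewrite ?kP ?(leq_trans mm) //.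
  by rewrite !grade_face !kC ?(leq_trans mm).
have st (i : 'I_n) : exists a, (a \in kk i.+1) && (a \notin kk i).
  have /properP[_ [a a1 a2]] : kk i \proper kk i.+1.
    by rewrite properEcard kS //= !kC // ltnW.
  by exists a; rewrite a1.
pose s0 i := xchoose (st i).
have s1 i : s0 i \in kk i.+1 by case/andP: (xchooseP (st i)).
have s2 i : s0 i \notin kk i by case/andP: (xchooseP (st i)).
have s_inj : injective s0.
  have h (i j : 'I_n) : i < j -> s0 i != s0 j.
    move=> ij; apply: contraNneq (s2 j) => <-.
    by apply: (subsetP (kS _ _ ij (ltnW (ltn_ord j)))).
  move=> i j e; apply: val_inj; case: (ltngtP i j) => // /h.
    by rewrite e eqxx.
  by rewrite e eqxx.
pose s := perm s_inj.
have sk m : m <= n -> pre s m = kk m.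
  move=> mn; apply/eqP; rewrite eqEcard card_pre // kC // leqnn andbT.
  apply/subsetP => a; rewrite inE -{2}(permKV s a); set i := (s^-1)%g a => im.
  by rewrite permE; apply: (subsetP (kS _ _ im mn)).
exists x, s; have /maxsetP[_ max_s] := flag_of_flag x s; apply: max_s => //.
apply/subsetP => G /flag_ofP[->|[m mn ->]]; last by rewrite sk ?kP.
by apply: (flag_comparable faces_po hPhi face0_in) => H _; rewrite /le face0_sub.
Qed.

(** * Strong flag-connectedness and adjacency *)

Lemma adjacent_flags (Phi Psi : {set graph V}) F :
  flag le faces Phi -> flag le faces Psi -> Phi != Psi ->
  Phi :\ F \subset Psi -> adjacent Phi Psi.
Proof.
move=> hPhi hPsi ne sub.
have cD : #|Phi :\: Psi| = 1.
  apply/eqP; rewrite eqn_leq -{1}(cards1 F) card_gt0 subset_leq_card /=.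
    rewrite setD_eq0; apply: contra ne => sPP; rewrite eqEcard sPP.
    by rewrite (card_flag_faces hPhi) (card_flag_faces hPsi) leqnn.
  apply/subsetP => G; rewrite !inE => /andP[GPsi GPhi].
  apply: contraNT GPsi => GF; apply: (subsetP sub); by rewrite !inE GF.
rewrite /adjacent cD eqxx /=; move: cD; rewrite !cardsD setIC.
by rewrite (card_flag_faces hPhi) (card_flag_faces hPsi) => ->.
Qed.

(** The common part [I] is a parameter of its own, so that the ends of a path can vary while [I]
    stays fixed. *)
Definition flag_step (I X Y : {set graph V}) : bool :=
  [&& flag le faces X, flag le faces Y, adjacent X Y, I \subset X & I \subset Y].

Lemma flag_step_intro (I : {set graph V}) x y s t F :
  I \subset flag_of x s -> F \notin I -> flag_of x s != flag_of y t ->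
  flag_of x s :\ F \subset flag_of y t ->
  flag_step I (flag_of x s) (flag_of y t) /\ I \subset flag_of y t.
Proof.
move=> Is FI ne sub; have It : I \subset flag_of y t.
  apply: subset_trans sub; apply/subsetP => G GI; rewrite in_setD1 (subsetP Is) //.
  by rewrite andbT; apply: contraNneq FI => <-.
split=> //; rewrite /flag_step !flag_of_flag Is It !andbT /=.
by apply: (@adjacent_flags _ _ F) => //; apply: flag_of_flag.
Qed.

(** Sort [s] towards [t]. Each swap changes only the face on the prefix of length [j]; by
    [pre_descent] this face is not in the flag of [t], hence not in [I]. *)
Lemma connect_same_vertex (I : {set graph V}) x s t :
  I \subset flag_of x s -> I \subset flag_of x t ->
  connect (flag_step I) (flag_of x s) (flag_of x t).
Proof.
move=> + It; move: s; apply: (@perm_sort_ind n t) => [_|s i j ji desc IH Is].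
  exact: connect0.
have ne := pre_descent ji desc.
have jn : j <= n by apply/ltnW.
have FI : face x (pre s j) \notin I.
  apply: contra ne => /(subsetP It); rewrite mem_flag_of card_pre //.
  by case/andP.
have [||st Is'] := @flag_step_intro I x x s (tperm i j * s)%g _ Is FI.
- apply/eqP => e; have : face x (pre s j) \in flag_of x (tperm i j * s)%g.
    by rewrite -e mem_flag_of card_pre // eqxx orb_refl.
  rewrite mem_flag_of card_pre // => /andP[/eqP/setP/(_ (s i))].
  rewrite mem_pre -[s i](_ : (tperm i j * s)%g j = _) ?mem_pre; last by rewrite permM tpermR.
  by rewrite ltnn ji ltnSn.
- apply/subsetP => G; rewrite in_setD1 => /andP[Gj /flag_ofP[->|[m mn eG]]].
    exact: face0_flag_of.
  rewrite eG mem_flag_of card_pre // orb_refl andbT pre_tperm_succ //.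
  by apply: contraNneq Gj => mj; rewrite eG mj.
exact: connect_trans (connect1 st) (IH Is').
Qed.

(** Every face of the flag of positive rank contains the edge of the first colour, hence both of its
    ends. *)
Lemma flag_of_flip x s (i : 'I_n) : i = 0 :> nat ->
  flag_of x s :\ face x (pre s 0) \subset flag_of (nb (s i) x) s.
Proof.
move=> i0; apply/subsetP => G; rewrite in_setD1 => /andP[G0 /flag_ofP[->|[m mn eG]]].
  exact: face0_flag_of.
rewrite eG mem_flag_of card_pre // eqxx /= orb_step ?orb_refl ?mem_pre //.
by rewrite i0 lt0n; apply: contraNneq G0 => m0; rewrite eG m0.
Qed.

Lemma vertex_flag_of x y s t : (face x (pre s 0) \in flag_of y t) = (x == y).
Proof. by rewrite mem_flag_of card_pre // !pre0 eqxx orb0 inE eq_sym. Qed.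

(** Let [m] be the least rank of a common nonempty face. A path from [x] to [y] uses only the first
    [m] colours of [s]. Before each step along a colour [a], the ordering is rearranged so that [a]
    comes first, which keeps all prefixes of length at least [m]. Sorting at [y] finishes. *)
Lemma faces_connected : strongly_flag_connected le faces.
Proof.
move=> _ _ /flagE[x [s ->]] /flagE[y [t ->]].
change (connect (flag_step (flag_of x s :&: flag_of y t))
          (flag_of x s) (flag_of y t)).
set I := _ :&: _; have Is : I \subset flag_of x s by apply: subsetIl.
have It : I \subset flag_of y t by apply: subsetIr.
have topI : exists m, (m <= n) && (face x (pre s m) \in flag_of y t).
  exists n; rewrite leqnn mem_flag_of card_pre // !preT // eqxx.
  by rewrite nb_conn inE.
case: (ex_minnP topI) => m /andP[mn xm_t] min_m.
have xmI : face x (pre s m) \in I.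
  by rewrite inE xm_t andbT mem_flag_of card_pre // eqxx orb_refl.
have IP G : G \in I -> G = face0 \/ exists2 j, m <= j <= n & G = face x (pre s j).
  rewrite inE => /andP[/flag_ofP[->|[j jn ->]] jt]; first by left.
  by right; exists j => //; rewrite jn min_m ?jn.
have yx : y \in orb (pre s m) x by move: xm_t; rewrite mem_flag_of => /andP[].
(* Freezing [I] lets the induction run over intermediate vertices, for which [I] is no longer given
   as an intersection of the two flags. *)
clearbody I; move: y yx t It {xm_t min_m topI} => y yx t It.
suff [s' ss' Is'] : exists2 s', connect (flag_step I) (flag_of x s) (flag_of y s')
    & I \subset flag_of y s'.
  exact: connect_trans ss' (connect_same_vertex Is' It).
move: y yx {t It}; apply: orb_ind; first by exists s.
move=> z a zx aK [s' ss' Is'].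
have /andP[/eqP sm _] : (pre s m == pre s' m) && (z \in orb (pre s m) x).
  by have := subsetP Is' _ xmI; rewrite mem_flag_of card_pre.
rewrite sm inE in aK; set k := (s'^-1)%g a in aK.
have n0 : 0 < n by apply: leq_ltn_trans (ltn_ord k).
pose i0 := Ordinal n0; pose s2 := (tperm i0 k * s')%g.
have s2a : s2 i0 = a by rewrite permM tpermL permKV.
have Is2 : I \subset flag_of z s2.
  apply/subsetP => G GI; have [->|[j /andP[mj jn] eG]] := IP _ GI.
    exact: face0_flag_of.
  have := subsetP Is' _ GI; rewrite eG !mem_flag_of card_pre // => /andP[/eqP-> ->].
  rewrite andbT pre_tperm //= (leq_trans aK mj).
  by rewrite (leq_trans _ mj) // (leq_ltn_trans _ aK).
have [|||st I3] := @flag_step_intro I z (nb a z) s2 s2 (face z (pre s2 0)) Is2.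
(* The vertex that is about to change is not in [I]: the position [k < m] of [a] forces [m > 0]. *)
- apply/negP => /IP[e|[j /andP[mj jn] /face_inj[e _]]].
    by have := face_neq0 z (pre s2 0); rewrite e eqxx.
  by have := card_pre s jn; rewrite -e pre0 cards0 => j0; move: mj; rewrite -j0 leqNgt (leq_ltn_trans _ aK).
- apply/eqP => e; have := vertex_flag_of z z s2 s2.
  by rewrite e vertex_flag_of eqxx eq_sym (negbTE (nb_neq a z)).
- by rewrite -s2a; apply: flag_of_flip.
exists s2 => //; apply: connect_trans ss' (connect_trans _ (connect1 st)).
exact: connect_same_vertex.
Qed.

Theorem faces_polytope : abstract_polytope n le faces.
Proof.
split; [exact: faces_po|exact: faces_extreme|exact: card_flag_faces
  |exact: faces_diamond|exact: faces_connected].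
Qed.

(** The flags differ in one rank [m]. If [m] is 0, all prefixes agree and the common edge leaves one
    choice for [y]; otherwise the vertices agree and the orderings differ at one prefix only. *)
Lemma adjacentP x y s t : adjacent (flag_of x s) (flag_of y t) ->
  (exists2 i : 'I_n, i = 0 :> nat & y = nb (s i) x /\ t = s) \/
  (x = y /\ exists i j : 'I_n, j = i.+1 :> nat /\ t = (tperm i j * s)%g).
Proof.
case/andP => /cards1P[F eF] _.
have mem G : G \in flag_of x s -> G != F -> G \in flag_of y t.
  move=> Gs GF; apply: contraNT GF => Gt.
  by rewrite -in_set1 -eF inE Gt.
have : F \in flag_of x s :\: flag_of y t by rewrite eF set11.
rewrite inE => /andP[Ft /flag_ofP[F0|[m mn eFm]]].
  by rewrite F0 face0_flag_of in Ft.
have pre_st m' : m' != m -> pre s m' = pre t m' /\ x \in orb (pre s m') y.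
  move=> ne; case: (leqP m' n) => [mn'|/ltnW nm']; last first.
    by rewrite !preT // nb_conn inE.
  have : face x (pre s m') \in flag_of y t.
    apply: mem; first by rewrite mem_flag_of card_pre // eqxx orb_refl.
    rewrite eFm; apply: contra ne => /eqP/face_inj[e _].
    by rewrite -(@card_pre n s m') // e card_pre.
  by rewrite mem_flag_of card_pre // orb_sym => /andP[/eqP].
have [m0|m0] := eqVneq m 0; last first.
  have [|_] := pre_st 0; first by rewrite eq_sym.
  rewrite pre0 orb0 => /set1P xy.
  right; split=> //; have st : s != t.
    by apply: contraNneq Ft => st; rewrite eFm mem_flag_of card_pre // st eqxx xy orb_refl.
  have [i [j [ji mj te]]] := pre_eq_but (fun m' ne => proj1 (pre_st m' ne)) st.
  by exists i, j.
left; have st : s = t.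
  apply: pre_inj => m'; have [->|] := eqVneq m' 0; first by rewrite !pre0.
  by rewrite -m0 => /pre_st[].
have xy : x != y.
  by apply: contraNneq Ft => xy; rewrite eFm m0 vertex_flag_of xy.
have [|_] := pre_st 1; first by rewrite m0.
have n0 : 0 < n.
  rewrite lt0n; apply: contraNneq xy => n0.
  have [|_] := pre_st 1; first by rewrite m0.
  have -> : pre s 1 = set0 by apply/setP => a; exfalso; have := leq_ltn_trans (leq0n a) (ltn_ord a); rewrite n0.
  by rewrite orb0 => /set1P->.
have -> : pre s 1 = [set s (Ordinal n0)].
  apply/setP => a; rewrite in_set1 -{1}(permKV s a) mem_pre ltnS leqn0.
  rewrite -(inj_eq (@perm_inj _ (s^-1)%g)) permK -val_eqE //.
rewrite orb1 => /set2P[e|e]; first by rewrite e eqxx in xy.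
by exists (Ordinal n0); rewrite // e nbK.
Qed.

(** * Action of vertex maps on faces and flags *)

Definition map_graph (W : finType) (g : W -> W) (H : graph W) : graph W :=
  (g @: H.1, [set g @: (e : {set W}) | e in H.2]).

Lemma map_face0 (g : V -> V) : map_graph g face0 = face0.
Proof. by rewrite /map_graph !imset0. Qed.

Lemma map_face (g : V -> V) (r : 'S_n) x K :
  (forall a z, g (nb a z) = nb (r a) (g z)) ->
  map_graph g (face x K) = face (g x) (r @: K).
Proof.
move=> gnb; have orbE : g @: orb K x = orb (r @: K) (g x).
  apply/setP => y; apply/imsetP/idP => [[z zx ->]|]; move: {+}y; last first.
    apply: orb_ind => [|z _ _ /imsetP[a aK ->] [w wx ->]].
      by exists x => //; apply: orb_refl.
    by exists (nb a w); [apply: orb_step|rewrite gnb].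
  move=> _; move: z zx; apply: orb_ind => [|z a _ aK zx]; first exact: orb_refl.
  by rewrite gnb; apply: orb_step => //; apply: imset_f.
rewrite /map_graph /face /= orbE; congr (_, _).
apply/setP => e; apply/imsetP/imset2P => [[_ /imset2P[z a zx aK ->] ->]|].
  exists (g z) (r a); first by rewrite -orbE imset_f.
    exact: imset_f.
  by rewrite imsetU1 imset_set1 gnb.
case=> y b; rewrite -orbE => /imsetP[z zx ->] /imsetP[a aK ->] ->.
by exists [set z; nb a z]; [apply: imset2_f|rewrite imsetU1 imset_set1 gnb].
Qed.

Lemma imset_pre (s r : 'S_n) m : r @: pre s m = pre (s * r) m.
Proof.
apply/setP => a; rewrite -{1}(permKV r a) mem_imset; last exact: perm_inj.
by rewrite !inE invMg permM.
Qed.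

Lemma map_flag_of (g : V -> V) (r : 'S_n) x s :
  (forall a z, g (nb a z) = nb (r a) (g z)) ->
  map_graph g @: flag_of x s = flag_of (g x) (s * r)%g.
Proof.
move=> gnb; rewrite /flag_of imsetU1 map_face0; congr (_ |: _).
by rewrite -imset_comp; apply: eq_imset => j; rewrite /= (map_face _ _ gnb) imset_pre.
Qed.

(** No compatibility of [g] with colours is assumed. By induction on [j], the image of the edge of
    colour [s j] has a colour among [t 0, ..., t j], and the earlier ones are taken by the images of
    the earlier edges at [z]. Both ends [z] of the first edge qualify, as they lie in every face of
    positive rank. *)
Lemma map_flag_nb (g : V -> V) x y s t : injective g ->
  (forall m, m <= n -> map_graph g (face x (pre s m)) = face y (pre t m)) ->
  forall (j : 'I_n) z, z \in orb (pre s 1) x -> g (nb (s j) z) = nb (t j) (g z).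
Proof.
move=> g_inj gE j z zx; have [m] := ubnP j; elim: m j => // m IH j lt_m.
have : g @: [set z; nb (s j) z] \in (face y (pre t j.+1)).2.
  rewrite -gE //; apply: imset_f; rewrite face_edge mem_pre ltnSn andbT.
  by apply: subsetP zx; apply: orb_sub (orb_refl _ _); apply: sub_pre.
rewrite imsetU1 imset_set1 => /imset2P[w b _]; rewrite -{1}(permKV t b) mem_pre.
set k := (t^-1)%g b => kj e.
have {e} e : g (nb (s j) z) = nb (t k) (g z).
  have : g (nb (s j) z) \in [set w; nb b w] by rewrite -e set22.
  have : g z \in [set w; nb b w] by rewrite -e set21.
  have ne : g (nb (s j) z) != g z by rewrite (inj_eq g_inj).
  rewrite permKV => /set2P[] gz /set2P[] gnz; move: ne; rewrite gz gnz ?nbK //.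
    by rewrite eqxx.
  by rewrite eqxx.
move: kj; rewrite ltnS leq_eqVlt => /orP[/eqP/val_inj kj|kj]; first by rewrite e kj.
have := IH k (leq_trans kj lt_m); rewrite -e => /g_inj/nb_inj/perm_inj kj'.
by rewrite kj' ltnn in kj.
Qed.

End ColourfulPolytope.

(** * Handedness in the cube *)

Definition flip (x : vertex) (i : 'I_4) : vertex :=
  [ffun j => x j (+) (j == i)].

Lemma flipK i : involutive (flip^~ i).
Proof. by move=> x; apply/ffunP => j; rewrite !ffunE -addbA addbb addbF. Qed.

Lemma flipC x i j : flip (flip x i) j = flip (flip x j) i.
Proof. by apply/ffunP => k; rewrite !ffunE addbAC. Qed.

Lemma flip_neq x i : flip x i != x.
Proof.
apply/eqP => /ffunP/(_ i); rewrite ffunE eqxx addbT; by case: (x i).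
Qed.

Lemma flip_inj x : injective (flip x).
Proof.
move=> i j /ffunP/(_ i); rewrite !ffunE eqxx => /addbI/esym/eqP; exact.
Qed.

(** Comparing coordinate [i] gives [l = i], and coordinate [k] then gives the claim: the two paths
    go round one square. *)
Lemma flip_square x i j k l :
  flip (flip x i) k = flip (flip x j) l -> i != j -> k != i -> k = j.
Proof.
move=> e ij ki; have li : l = i.
  move/ffunP/(_ i): e; rewrite !ffunE eqxx (negbTE ij) eq_sym (negbTE ki).
  by case: eqP => [->|] //; case: (x i).
move/ffunP/(_ k): e; rewrite !ffunE eqxx li (negbTE ki).
by case: eqP => //; case: (x k).
Qed.

Lemma flip_ind x (Q : vertex -> Prop) : Q x -> (forall z i, Q z -> Q (flip z i)) ->
  forall z, Q z.
Proof.
move=> Qx Qf z; have [m] := ubnP #|[pred i | x i != z i]|.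
elim: m z => // m IH z lt_m.
have [i xi|xz] := pickP [pred i | x i != z i]; last first.
  suff <- : x = z by []; apply/ffunP => i; apply/eqP.
  by have /negbFE := xz i.
rewrite -(flipK i z); apply/Qf/IH; rewrite -ltnS; apply: leq_trans lt_m; rewrite ltnS.
apply: proper_card; apply/properP; split; last first.
  exists i => //; rewrite inE ffunE eqxx addbT negbK.
  by move: xi => /=; case: (x i); case: (z i).
apply/subsetP => j; rewrite !inE ffunE; case: (eqVneq j i) => [->|]; last by rewrite addbF.
by [].
Qed.

Definition o1 : 'I_4 := @Ordinal 4 1 isT.
Definition o2 : 'I_4 := @Ordinal 4 2 isT.
Definition o3 : 'I_4 := @Ordinal 4 3 isT.

Lemma ord4P (i : 'I_4) : [\/ i = ord0, i = o1, i = o2 | i = o3].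
Proof.
by case: i => [[|[|[|[|//]]]] lt]; [constructor 1|constructor 2|constructor 3|
  constructor 4]; apply: val_inj.
Qed.

Lemma perm3P (a b c : 'I_4) : a != b -> a != c -> b != c ->
  exists s : 'S_4, [/\ s ord0 = a, s o1 = b & s o2 = c].
Proof.
move=> ab ac bc; pose s0 := tperm ord0 a; pose s1 := (s0 * tperm (s0 o1) b)%g.
have s00 : s0 ord0 = a by rewrite tpermL.
have s01 : s0 o1 != a by rewrite -s00 (inj_eq perm_inj).
have s10 : s1 ord0 = a by rewrite permM s00 tpermD // eq_sym.
have s11 : s1 o1 = b by rewrite permM tpermL.
have s12a : s1 o2 != a by rewrite -s10 (inj_eq perm_inj).
have s12b : s1 o2 != b by rewrite -s11 (inj_eq perm_inj).
exists (s1 * tperm (s1 o2) c)%g; split; rewrite permM ?tpermL //.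
  by rewrite s10 tpermD // eq_sym.
by rewrite s11 tpermD // eq_sym.
Qed.

Section Rainbow.

Variable col : vertex -> 'I_4 -> 'I_4.
Hypothesis col_flip : forall x i, col (flip x i) i = col x i.
Hypothesis col_inj : forall x, injective (col x).
(** Opposite sides of a square differ in colour; adjacent sides do by [col_inj], so every square is
    rainbow. *)
Hypothesis col_square : forall x i j, i != j -> col (flip x i) j != col x j.
Implicit Types (x y z : vertex) (i j k : 'I_4) (a b c : 'I_4) (s t r : 'S_4).

Definition dir x : 'I_4 -> 'I_4 := invF (@col_inj x).

Lemma colK x : cancel (col x) (dir x). Proof. exact: invF_f. Qed.
Lemma dirK x : cancel (dir x) (col x). Proof. exact: f_invF. Qed.

Definition nb a x : vertex := flip x (dir x a).

Lemma nb_col x i : nb (col x i) x = flip x i.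
Proof. by rewrite /nb colK. Qed.

Lemma nbK a : involutive (nb a).
Proof.
move=> x; rewrite -{2}(flipK (dir x a) x) -/(nb a x) -nb_col col_flip.
by rewrite dirK.
Qed.

Lemma nb_inj x : injective (nb^~ x).
Proof. by move=> a b /flip_inj/(can_inj (@dirK x)). Qed.

Lemma nb_neq a x : nb a x != x. Proof. exact: flip_neq. Qed.

Lemma nb_conn x : orb nb setT x = setT.
Proof.
apply/setP => y; rewrite [RHS]inE; move: y; apply: flip_ind.
  exact: orb_refl.
by move=> z i zx; rewrite -nb_col orb_step ?in_setT.
Qed.

(** In the square spanned at [x] by the edges of colours [a] and [b], this is the colour of the side
    opposite to the [b]-edge. *)
Let turn x a b := col (nb a x) (dir x b).

Lemma turn_neq1 x a b : a != b -> turn x a b != a.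
Proof.
move=> ab; rewrite -{2}(dirK x a) -(col_flip x) (inj_eq (@col_inj _)).
by rewrite (can_eq (dirK x)) eq_sym.
Qed.

Lemma turn_neq2 x a b : a != b -> turn x a b != b.
Proof.
by move=> ab; rewrite -{2}(dirK x b) col_square // (can_eq (dirK x)).
Qed.

Lemma turnC x a b : a != b -> turn x a b != turn x b a.
Proof.
move=> ab; rewrite /turn /nb -(col_flip _ (dir x b)) -[X in _ != X](col_flip _ (dir x a)).
by rewrite flipC (inj_eq (@col_inj _)) (can_eq (dirK x)) eq_sym.
Qed.

Lemma turn_inj x a : injective (turn x a).
Proof. by move=> b c /col_inj/(can_inj (@dirK x)). Qed.

Definition hand x s : bool := turn x (s ord0) (s o1) == s o2.

Lemma perm4P s a : [\/ a = s ord0, a = s o1, a = s o2 | a = s o3].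
Proof.
rewrite -(permKV s a); case: (ord4P (s^-1%g a)) => ->;
  by [constructor 1|constructor 2|constructor 3|constructor 4].
Qed.

(** Let [s] list [a, b, c, d]. For the swap of [a, b]: [turn x a b] and [turn x b a] are [c] and [d]
    in some order. For [b, c]: [turn x a] permutes [b, c, d] without fixed points, hence cyclically.
    For [c, d]: the value of [turn] stays and is compared with the other candidate. *)
Lemma hand_tperm x s i j : j = i.+1 :> nat ->
  hand x (tperm i j * s)%g = ~~ hand x s.
Proof.
have neq k l : (s k == s l) = (k == l) by rewrite (inj_eq perm_inj).
have n01 : s ord0 != s o1 by rewrite neq.
have n02 : s ord0 != s o2 by rewrite neq.
have n03 : s ord0 != s o3 by rewrite neq.
have t01 := turn_neq1 x n01; have t01' := turn_neq2 x n01.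
have t02 := turn_neq1 x n02; have t02' := turn_neq2 x n02.
have t03 := turn_neq1 x n03; have t03' := turn_neq2 x n03.
have tC := turnC x n01.
have inj := @turn_inj x (s ord0).
rewrite eq_sym in n01.
have t10 := turn_neq1 x n01; have t10' := turn_neq2 x n01.
have d1 : turn x (s ord0) (s o1) != turn x (s ord0) (s o2) by rewrite (inj_eq inj) neq.
have d2 : turn x (s ord0) (s o1) != turn x (s ord0) (s o3) by rewrite (inj_eq inj) neq.
have d3 : turn x (s ord0) (s o2) != turn x (s ord0) (s o3) by rewrite (inj_eq inj) neq.
case: (ord4P i) => -> ji.
- have -> : j = o1 by apply: val_inj.
  rewrite /hand !permM tpermL tpermR tpermD //.
  move: t01 t01' t10 t10' tC.
  case: (perm4P s (turn x (s ord0) (s o1))) => ->; rewrite ?eqxx //;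
  case: (perm4P s (turn x (s o1) (s ord0))) => ->; rewrite ?eqxx // !neq //.
- have -> : j = o2 by apply: val_inj.
  rewrite /hand !permM tpermL tpermR tpermD //.
  move: t01 t01' t02 t02' t03 t03' d1 d2 d3.
  case: (perm4P s (turn x (s ord0) (s o1))) => ->; rewrite ?eqxx //;
  case: (perm4P s (turn x (s ord0) (s o2))) => ->; rewrite ?eqxx //;
  case: (perm4P s (turn x (s ord0) (s o3))) => ->; rewrite ?eqxx // !neq //.
- have -> : j = o3 by apply: val_inj.
  rewrite /hand !permM tpermL !tpermD //.
  move: t01 t01'.
  case: (perm4P s (turn x (s ord0) (s o1))) => ->; rewrite ?eqxx // !neq //.
by move: (ltn_ord j); rewrite ji.
Qed.

(** At the [a]-neighbour of [x], the map [turn _ a] is the inverse of what it is at [x], so the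
    second and third colours exchange roles. *)
Lemma hand_nb x s : hand (nb (s ord0) x) s = ~~ hand x s.
Proof.
rewrite -(@hand_tperm x s o1 o2) // /hand !permM tpermL tpermR tpermD //.
by rewrite /turn nbK; apply/eqP/eqP => <-; rewrite colK dirK.
Qed.

(** Each adjacent swap reverses both hands, so agreement for one ordering spreads to all. *)
Lemma hand_match x y s t r : hand x s = hand y (s * r)%g ->
  hand x t = hand y (t * r)%g.
Proof.
move=> h; move: t; apply: (@perm_sort_ind _ s) => // t i j ji _.
by rewrite -mulgA !hand_tperm // => /negb_inj.
Qed.

(** * The signed permutation carrying a flag to another of the same hand *)

Section Symmetry.

Variables (x y : vertex) (s t : 'S_4).
Hypothesis hand_st : hand x s = hand y t.

Definition recolour : 'S_4 := (s^-1 * t)%g.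

Lemma redirect_inj : injective (fun i => dir y (recolour (col x i))).
Proof. by move=> i j /(can_inj (@dirK y))/perm_inj/col_inj. Qed.

Definition redirect : 'S_4 := perm redirect_inj.

Definition shift : vertex :=
  [ffun i => y i (+) x ((redirect^-1)%g i)].

(** Adding booleans multiplies signs, so this is a signed permutation: [redirect] matches the edges
    at [x] with those at [y], and [shift] is fixed by sending [x] to [y]. *)
Definition move_vertex z : vertex :=
  [ffun i => shift i (+) z ((redirect^-1)%g i)].

Lemma move_base : move_vertex x = y.
Proof. by apply/ffunP => i; rewrite !ffunE -addbA addbb addbF. Qed.

Lemma move_flip z i : move_vertex (flip z i) = flip (move_vertex z) (redirect i).
Proof.
apply/ffunP => k; rewrite !ffunE addbA; congr (_ (+) _).
by rewrite (canF_eq (permKV redirect)).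
Qed.

Lemma recolour_base : (s * recolour)%g = t.
Proof. by rewrite mulgA mulgV mul1g. Qed.

(** Both claims are carried along edges from [x]. Crossing an edge reverses both hands; the colour
    in direction [j] after crossing direction [i] is a [turn] at [z], which the hand determines from
    the colours at [z]. *)
Lemma move_col_hand z : hand z s = hand (move_vertex z) t /\
  forall i, col (move_vertex z) (redirect i) = recolour (col z i).
Proof.
move: z; apply: (@flip_ind x) => [|z i [hz cz]].
  by rewrite move_base; split => // i; rewrite permE dirK.
have nb_move j : nb (recolour (col z j)) (move_vertex z) =
    flip (move_vertex z) (redirect j) by rewrite -cz nb_col.
have hand_z r : hand z r = hand (move_vertex z) (r * recolour)%g.
  by apply: (@hand_match _ _ s); rewrite recolour_base.
split.
  (* Any ordering that starts with the colour of the crossed edge would do, because [hand_nb]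
     concerns the first colour. *)
  rewrite -recolour_base; apply: (@hand_match _ _ (tperm ord0 (col z i))).
  set r := tperm _ _; have r0 : r ord0 = col z i by rewrite tpermL.
  rewrite move_flip -nb_move -nb_col -r0 hand_nb hand_z -hand_nb.
  by rewrite permM.
move=> j; rewrite move_flip; have [->|ij] := eqVneq i j.
  by rewrite !col_flip cz.
(* The third entry is the colour to be transported, so [hand z r] holds by construction, and its
   counterpart at the image names the colour there. *)
have [|||r [r0 r1 r2]] := @perm3P (col z i) (col z j) (col (flip z i) j).
- by rewrite (inj_eq (@col_inj _)).
- by rewrite -(col_flip z i) (inj_eq (@col_inj _)).
- by rewrite eq_sym col_square.
have : hand z r by rewrite /hand r0 r1 r2 /turn nb_col colK.
have rE k : (r * recolour)%g k = recolour (r k) by apply: permM.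
rewrite hand_z /hand !rE r0 r1 r2 /turn nb_move -[in dir _ _]cz colK.
by move/eqP.
Qed.

Lemma move_nb z a : move_vertex (nb a z) = nb (recolour a) (move_vertex z).
Proof.
have [_ cz] := move_col_hand z.
by rewrite -{2}(dirK z a) -cz nb_col -move_flip.
Qed.

End Symmetry.

(** This expresses the hand through adjacency of vertices, which symmetries respect. The condition
    [a != c] excludes the path that returns to [x], a neighbour of [nb b x] in any case. *)
Lemma turn_adjacent x a b c : a != b -> a != c ->
  turn x a b == c <-> exists k, nb c (nb a x) = flip (nb b x) k.
Proof.
move=> ab ac; split=> [/eqP<-|[k e]].
  by exists (dir x a); rewrite /turn nb_col flipC.
apply/eqP; rewrite /turn; suff <- : dir (nb a x) c = dir x b by rewrite dirK.
apply: flip_square e _ _; first by rewrite (can_eq (dirK x)).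
rewrite -(can_eq (@colK (nb a x))) dirK col_flip dirK eq_sym //.
Qed.

(** By [map_flag_nb], [g] sends the three coloured edges occurring in [turn_adjacent] to edges of
    the corresponding colours. *)
Lemma map_flag_hand (g : vertex -> vertex) x y s t : injective g ->
  (forall z i, exists k, g (flip z i) = flip (g z) k) ->
  (forall m, m <= 4 ->
     map_graph g (face nb x (pre s m)) = face nb y (pre t m)) ->
  hand x s = hand y t.
Proof.
move=> g_inj g_flip gE.
have gnb := map_flag_nb nbK nb_inj nb_neq g_inj gE.
have gx : g x = y.
  have [/setP/(_ (g x))] := gE 0 isT.
  by rewrite !pre0 !orb0 imset_set1 !inE eqxx => /esym/eqP.
have x1 : x \in orb nb (pre s 1) x by apply: orb_refl.
have x2 : nb (s ord0) x \in orb nb (pre s 1) x by rewrite orb_step // mem_pre.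
(* The case of the last colour is included because a false hand means that [turn] is the fourth
   colour; this yields the converse. *)
have step (k : 'I_4) : 1 < k -> turn x (s ord0) (s o1) == s k ->
    turn y (t ord0) (t o1) == t k.
  move=> k1; have neq (r : 'S_4) : r ord0 != r k.
    by rewrite (inj_eq perm_inj); apply: contraTneq k1 => <-.
  have neq1 (r : 'S_4) : r ord0 != r o1 by rewrite (inj_eq perm_inj).
  move=> /turn_adjacent [//|//|l e]; apply/turn_adjacent => //.
  have [l' e'] := g_flip (nb (s o1) x) l; exists l'.
  by rewrite -gx -!gnb // e.
apply/idP/idP; first exact: step.
apply: contraTT => hx.
have : hand x (tperm o2 o3 * s)%g by rewrite hand_tperm.
rewrite /hand !permM tpermL !tpermD // => /(step o3 isT) hy.
by rewrite -/(hand y t) -(@hand_tperm y t o2 o3) // /hand !permM tpermL !tpermD.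
Qed.

End Rainbow.

(** * Chiral colourings *)

Lemma set2_eqP (T : finType) (x y u v : T) : [set x; y] = [set u; v] ->
  (x = u /\ y = v) \/ (x = v /\ y = u).
Proof.
move=> e; have : x \in [set u; v] by rewrite -e set21.
have : y \in [set u; v] by rewrite -e set22.
have : u \in [set x; y] by rewrite e set21.
have : v \in [set x; y] by rewrite e set22.
by do 4![case/set2P => ?]; subst; auto.
Qed.

Lemma cube_edges_dirP i (e : {set vertex}) :
  reflect (exists x, e = [set x; flip x i]) (e \in cube_edges_dir i).
Proof.
apply: (iffP imsetP) => [[[x y] /= h ->]|[x ->]].
  exists x; congr [set _; _]; apply/ffunP => j; rewrite ffunE.
  by move: h; rewrite inE => /forallP/(_ j)/eqP <- /=; case: (x j); case: (y j).
exists (x, flip x i) => //; rewrite inE; apply/forallP => j /=.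
by rewrite ffunE; case: (x j); case: (j == i).
Qed.

Lemma cube_edgesP (e : {set vertex}) :
  reflect (exists x i, e = [set x; flip x i]) (e \in cube_edges).
Proof.
apply: (iffP bigcupP) => [[i _ /cube_edges_dirP[x ->]]|[x [i ->]]].
  by exists x, i.
by exists i => //; apply/cube_edges_dirP; exists x.
Qed.

Lemma cube_edge_dir x i : [set x; flip x i] \in cube_edges_dir i.
Proof. by apply/cube_edges_dirP; exists x. Qed.

Lemma cube_edge x i : [set x; flip x i] \in cube_edges.
Proof. by apply/cube_edgesP; exists x, i. Qed.

Lemma cube_edge_pairP x y :
  reflect (exists i, y = flip x i) ([set x; y] \in cube_edges).
Proof.
apply: (iffP idP) => [/cube_edgesP[z [i /set2_eqP[[-> ->]|[-> ->]]]]|[i ->]].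
- by exists i.
- by exists i; rewrite flipK.
exact: cube_edge.
Qed.

Lemma qedge_antipodes x y i j : qedge [set x; flip x i] = qedge [set y; flip y j] ->
  [\/ x = y, x = flip y j, x = antipode y | x = antipode (flip y j)].
Proof.
move=> e; have : [set x; flip x i] \in qedge [set y; flip y j] by rewrite -e set21.
case/set2P => e'; have : x \in [set x; flip x i] by rewrite set21.
  by rewrite e' => /set2P[]; [constructor 1|constructor 2].
rewrite e' imsetU1 imset_set1.
by case/set2P; [constructor 3|constructor 4].
Qed.

Lemma antipode_neq (x y : vertex) l : x l = y l -> x <> antipode y.
Proof. by move=> xy /ffunP/(_ l); rewrite ffunE xy; case: (y l). Qed.

(** Flips in directions [i] and [j] leave coordinate [l] alone, and vertices agreeing in a
    coordinate are not antipodal. *)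
Lemma ord4_other (i j : 'I_4) : exists2 l : 'I_4, l != i & l != j.
Proof.
case: (ord4P i) => ->; case: (ord4P j) => ->;
  solve [exists ord0 => //|exists o1 => //|exists o2 => //].
Qed.

Lemma map_graph_inj (W : finType) (g : W -> W) :
  injective g -> injective (map_graph g).
Proof.
move=> g_inj [A1 A2] [B1 B2] [/(imset_inj g_inj)-> e]; congr (_, _).
by apply: imset_inj e; apply: imset_inj.
Qed.

Section Chiral.

Variables (c : colouring) (hc : chiral_colouring c).
Implicit Types (x y z : vertex) (i j k : 'I_4) (K : {set 'I_4}).

Definition col x i : 'I_4 := lift_colouring c [set x; flip x i].

Lemma col_flip x i : col (flip x i) i = col x i.
Proof. by rewrite /col flipK setUC. Qed.

(** Two edges at [x] of one colour have images that share the class of [x], so these coincide in a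
    matching; but distinct edges at [x] are never antipodal. *)
Lemma col_inj x : injective (col x).
Proof.
move=> i j eij; have [[_ _ dis _] _] := hc (col x i).
set Ei := qedge [set x; flip x i]; set Ej := qedge [set x; flip x j].
have x_ends k : qvertex x \in qends (qedge [set x; flip x k]).
  apply: imset_f; apply/bigcupP; exists [set x; flip x k]; first exact: set21.
  exact: set21.
have E : Ei = Ej.
  apply/eqP; apply: contraT => ne.
  have : [disjoint qends Ei & qends Ej].
    apply: dis => //; rewrite inE imset_f ?cube_edge //=.
    exact/eqP/esym.
  by move/disjointFr => /(_ _ (x_ends i)); rewrite x_ends.
have [l li lj] := ord4_other i j.
have : [set x; flip x i] \in Ej by rewrite -E set21.
case/set2P => [/set2_eqP[[_ /flip_inj //]|[/eqP + _]]|].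
  by rewrite eq_sym (negbTE (flip_neq x j)).
rewrite imsetU1 imset_set1 => /set2_eqP[[/(@antipode_neq _ _ l)[]//]|].
by case=> /(@antipode_neq _ _ l)[]; rewrite ffunE (negbTE lj) addbF.
Qed.

(** Parallel edges of one colour have the same image, as a colour has one edge per direction;
    opposite sides of a square are neither equal nor antipodal. *)
Lemma col_square x i j : i != j -> col (flip x i) j != col x j.
Proof.
move=> ij; apply/eqP => e.
have [_ /(_ j)/eqP/cards1P[E eE]] := hc (col x j).
have inE' y : col y j = col x j -> qedge [set y; flip y j] = E.
  move=> ey; apply/set1P; rewrite -eE inE imset_f ?cube_edge_dir //=.
  exact/eqP.
have [l li lj] := ord4_other i j.
have := inE' _ e; rewrite -(inE' x erefl) => /qedge_antipodes[].
- by apply/eqP; apply: flip_neq.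
- by move/flip_inj/eqP; apply/negP.
- by apply: (@antipode_neq _ _ l); rewrite ffunE (negbTE li) addbF.
by apply: (@antipode_neq _ _ l); rewrite !ffunE (negbTE li) (negbTE lj).
Qed.

(** * Faces of [Qhat] as orbits of sets of colours *)

Local Notation nb := (nb col_inj).
Local Notation face := (face nb).

Let nbK := nbK col_flip col_inj.
Let nb_inj := @nb_inj _ col_inj.
Let nb_neq := nb_neq col_inj.
Let nb_conn := nb_conn col_inj.

Lemma nb_edge a x : [set x; nb a x] \in cube_edges.
Proof. exact: cube_edge. Qed.

Lemma lift_colouring_nb a x : lift_colouring c [set x; nb a x] = a.
Proof. exact: (@dirK _ col_inj). Qed.

Lemma cube_edge_nb e : e \in cube_edges -> exists x a, e = [set x; nb a x].
Proof.
by case/cube_edgesP => x [i ->]; exists x, (col x i); rewrite (@nb_col _ col_inj).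
Qed.

Lemma coloured_edgeP K u v :
  ([set u; v] \in [set e in cube_edges | lift_colouring c e \in K]) =
  [exists a in K, v == nb a u].
Proof.
rewrite inE; apply/andP/exists_inP => [[/cube_edge_pairP[i ->] aK]|[a aK /eqP->]].
  by exists (col u i); rewrite // (@nb_col _ col_inj).
by rewrite nb_edge lift_colouring_nb.
Qed.

Lemma cover_coloured K x : K != set0 ->
  x \in cover [set e in cube_edges | lift_colouring c e \in K].
Proof.
case/set0Pn => a aK; apply/bigcupP; exists [set x; nb a x]; last exact: set21.
by rewrite coloured_edgeP; apply/exists_inP; exists a.
Qed.

(** A nonempty [K] has an edge at every vertex, so the coloured subgraph reaches all of them;
    without colours its vertex set would be empty. *)
Lemma component_face K x : K != set0 ->
  component (edge_subgraph [set e in cube_edges | lift_colouring c e \in K]) x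
  = face x K.
Proof.
move=> K0; set E := [set e in cube_edges | _].
have Wx : [set y in (edge_subgraph E).1 |
    connect (fun u v => [set u; v] \in (edge_subgraph E).2) x y] = orb nb K x.
  apply/setP => y; rewrite inE [RHS]inE /=.
  rewrite cover_coloured //=; by apply: eq_connect => u v; rewrite coloured_edgeP.
rewrite /component Wx; congr (_, _); apply/setP => e; rewrite inE.
apply/andP/imset2P => [[]|[z a zx aK ->]].
  rewrite /= inE => /andP[/cube_edge_nb[z [a ->]]].
  rewrite lift_colouring_nb => aK /subsetP sub.
  by exists z a => //; apply: sub; apply: set21.
rewrite /= inE nb_edge lift_colouring_nb aK; split=> //.
by apply/subsetP => w /set2P[]-> //; apply: orb_step.
Qed.

Lemma colour_componentsP m F : 0 < m ->
  reflect (exists x K, #|K| = m /\ F = face x K) (F \in colour_components c m).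
Proof.
move=> m0; have K0 K : #|K| = m -> K != set0 by rewrite -card_gt0 => ->.
apply: (iffP bigcupP) => [[K /eqP cK /imsetP[x _ ->]]|[x [K [cK ->]]]].
  by exists x, K; rewrite component_face ?K0.
exists K; first exact/eqP.
by apply/imsetP; exists x; rewrite ?component_face ?K0 // cover_coloured ?K0.
Qed.

Lemma face_set0 x : face x set0 = ([set x], set0).
Proof.
rewrite /face orb0; congr (_, _); apply/setP => e; rewrite inE.
by apply/imset2P => -[z a _]; rewrite inE.
Qed.

Lemma face_set1 x a : face x [set a] = ([set x; nb a x], [set [set x; nb a x]]).
Proof.
rewrite /face (orb1 nbK); congr (_, _); apply/setP => e; rewrite inE.
apply/imset2P/eqP => [[z b /set2P[]-> /set1P-> ->] //|->].
  by rewrite nbK setUC.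
by exists x a; rewrite ?set11 ?set21.
Qed.

Lemma face_setT x : face x setT = cube_graph.
Proof.
rewrite /face nb_conn; congr (_, _); apply/setP => e.
apply/imset2P/idP => [[z a _ _ ->]|/cube_edge_nb[z [a ->]]]; first exact: nb_edge.
by exists z a.
Qed.

Lemma Qhat_rankP (k : nat) F :
  reflect (exists x K, #|K| = k /\ F = face x K) (F \in Qhat_rank c (Posz k)).
Proof.
case: k => [|[|[|[|[|k]]]]] /=.
- apply: (iffP imsetP) => [[x _ ->]|[x [K [/cards0_eq -> ->]]]].
    by exists x, set0; rewrite cards0 face_set0.
  by exists x; rewrite ?face_set0.
- apply: (iffP imsetP) => [[e /cube_edge_nb[x [a ->]] ->]|[x [K [/eqP/cards1P[a ->] ->]]]].
    by exists x, [set a]; rewrite cards1 face_set1.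
  by exists [set x; nb a x]; rewrite ?nb_edge ?face_set1.
- exact: colour_componentsP.
- exact: colour_componentsP.
- apply: (iffP set1P) => [->|[x [K [cK ->]]]].
    by exists [ffun=> false], setT; rewrite cardsT card_ord face_setT.
  suff -> : K = setT by exact: face_setT.
  by apply/eqP; rewrite eqEcard subsetT cK cardsT card_ord.
rewrite inE; constructor=> -[x [K [cK _]]].
by have := max_card (mem K); rewrite card_ord cK.
Qed.

Lemma Qhat_faces : Qhat c = faces nb.
Proof.
apply/setP => F; apply/bigcupP/facesP => [[i _]|].
  case: i => [[|i] lt_i]; first by rewrite /= => /set1P->; left.
  have -> : ((Ordinal lt_i : nat)%:Z - 1)%R = i by rewrite /=; lia.
  by case/Qhat_rankP => x [K [_ ->]]; right; exists x, K.
case=> [->|[x [K ->]]]; first by exists ord0 => //; rewrite set11.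
have cK : #|K|.+1 < 6 by rewrite !ltnS (leq_trans (max_card _)) ?card_ord.
exists (Ordinal cK) => //.
have -> : ((Ordinal cK : nat)%:Z - 1)%R = #|K| by rewrite /=; lia.
by apply/Qhat_rankP; exists x, K.
Qed.

Lemma Qhat_polytope : abstract_polytope 4 (@subgraph_of vertex) (Qhat c).
Proof.
rewrite Qhat_faces.
exact: (faces_polytope [ffun=> false] nbK nb_inj nb_neq nb_conn).
Qed.

Lemma faces_of_rank_Qhat (k : int) :
  faces_of_rank (@subgraph_of vertex) (Qhat c) k = Qhat_rank c k.
Proof.
have rankF x K := face_rank_face nbK nb_inj nb_neq x K.
have rank0 := face_rank_face0 nbK nb_inj nb_neq.
rewrite Qhat_faces; apply/setP => F; rewrite inE; case: k => k.
  apply/andP/Qhat_rankP => [[/facesP[->|[x [K ->]]]]|[x [K [cK ->]]]].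
  - by rewrite rank0.
  - by rewrite rankF => /eqP[cK]; exists x, K.
  by rewrite face_in rankF cK.
apply/andP/idP => [[/facesP[->|[x [K ->]]]]|].
- by rewrite rank0; case: k => //= _; rewrite set11.
- by rewrite rankF.
case: k => [|k]; last by rewrite inE.
by move/set1P->; rewrite face0_in rank0.
Qed.


(** * Hands of the flags of [Qhat] *)

Local Notation flag_of := (flag_of nb).
Local Notation hand := (hand col_inj).
Implicit Types (s t : 'S_4).

Lemma flag_Qhat (Phi : {set graph vertex}) :
  flag (@subgraph_of vertex) (Qhat c) Phi <-> exists x s, Phi = flag_of x s.
Proof.
rewrite Qhat_faces; split=> [|[x [s ->]]].
  exact: (flagE [ffun=> false] nbK nb_inj nb_neq nb_conn).
exact: (flag_of_flag [ffun=> false] nbK nb_inj nb_neq nb_conn).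
Qed.

Lemma hand_adjacent x y s t :
  adjacent (flag_of x s) (flag_of y t) -> hand y t = ~~ hand x s.
Proof.
case/(adjacentP nbK nb_inj nb_neq nb_conn) => [[i i0 [-> ->]]|[-> [i [j [ji ->]]]]].
  have -> : i = ord0 by apply: val_inj.
  exact: (hand_nb col_flip col_inj col_square).
exact: (hand_tperm col_flip col_inj col_square).
Qed.

Lemma Qhat_rank_edges (k : int) F : F \in Qhat_rank c k -> F.2 \subset cube_edges.
Proof.
case: k => k; last by case: k => [|k] /=; rewrite inE // => /eqP->; apply: sub0set.
case/Qhat_rankP => x [K [_ ->]].
by apply/subsetP => _ /imset2P[z a _ _ ->]; apply: nb_edge.
Qed.

Lemma flag_of_Qhat_rank x s F : F \in flag_of x s -> exists k : int, F \in Qhat_rank c k.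
Proof.
case/flag_ofP => [->|[m m4 ->]]; first by exists (Negz 0); rewrite /= set11.
by exists (Posz m); apply/Qhat_rankP; exists x, (pre s m); rewrite card_pre.
Qed.

(** Preservation of rank 1 makes [g] respect adjacency; preservation of every rank matches the faces
    of the two flags one by one. *)
Lemma map_flag_of_hand (g : vertex -> vertex) x y s t : injective g ->
  (forall k : int, map_graph g @: Qhat_rank c k \subset Qhat_rank c k) ->
  map_graph g @: flag_of x s = flag_of y t -> hand x s = hand y t.
Proof.
move=> g_inj g_rank gE; apply: (map_flag_hand col_flip col_square g_inj).
  move=> z i; have /subsetP/(_ (map_graph g (face z [set col z i]))) := g_rank 1%N.
  rewrite imset_f; last by apply/Qhat_rankP; exists z, [set col z i]; rewrite cards1.
  move=> /(_ isT) /imsetP[e eE]; rewrite face_set1 (@nb_col _ col_inj) => -[e1 _].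
  by apply/cube_edge_pairP; move: eE; rewrite -e1 /= imsetU1 imset_set1.
move=> m m4; have /subsetP/(_ (map_graph g (face x (pre s m)))) := g_rank m.
rewrite imset_f; last by apply/Qhat_rankP; exists x, (pre s m); rewrite card_pre.
move=> /(_ isT) /Qhat_rankP[z [K [cK e]]].
have : map_graph g (face x (pre s m)) \in flag_of y t.
  by rewrite -gE imset_f // (mem_flag_of nbK nb_inj nb_neq) card_pre // eqxx orb_refl.
rewrite e (mem_flag_of nbK nb_inj nb_neq) cK => /andP[/eqP-> yz].
by rewrite (face_base nbK yz).
Qed.

(** The map is given in coordinates so that a signed permutation of space realises it; a permutation
    of directions acts on coordinates through its inverse. *)
Lemma hand_transitive x y s t : hand x s = hand y t ->
  exists (p : 'S_4) (w : vertex), let g z := [ffun i => w i (+) z (p i)] in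
    (forall k : int, map_graph g @: Qhat_rank c k = Qhat_rank c k) /\
    map_graph g @: flag_of x s = flag_of y t.
Proof.
move=> e; exists (redirect col_inj x y s t)^-1%g, (shift col_inj x y s t).
set g := fun z => _; have gE : g = move_vertex col_inj x y s t by [].
have g_inj : injective g.
  move=> u v /ffunP h; apply/ffunP => i.
  have := h ((redirect col_inj x y s t) i).
  by rewrite /g !ffunE permK => /addbI.
have gnb a z : g (nb a z) = nb (recolour s t a) (g z).
  by rewrite gE; apply: (move_nb col_flip col_square).
split; last first.
  by rewrite (map_flag_of _ _ gnb) recolour_base gE move_base.
(* One inclusion suffices, as an injective map preserves the number of faces. *)
move=> k; apply/eqP; rewrite eqEcard card_imset ?leqnn ?andbT; last first.
  exact: map_graph_inj.
apply/subsetP => _ /imsetP[F + ->]; case: k => k.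
  case/Qhat_rankP => z [K [cK ->]]; apply/Qhat_rankP.
  exists (g z), (recolour s t @: K); rewrite (map_face _ _ gnb); split=> //.
  by rewrite card_imset //; apply: perm_inj.
case: k => [|k]; last by rewrite inE.
by move=> /set1P->; rewrite map_face0 set11.
Qed.

End Chiral.

(** * Realisation in space *)

From mathcomp Require Import boolp classical_sets functions cardinality reals.
Import Order.TTheory GRing.Theory Num.Theory.
Local Open Scope card_scope.
Local Open Scope classical_set_scope.
Local Open Scope ring_scope.

Section Realisation.

Variables (R : realType) (m : nat).
Implicit Types (p q : 'rV[R]_m) (f : 'rV[R]_m -> 'rV[R]_m).

Lemma segment_sym p q : segment p q = segment q p.
Proof.
suff sub : forall u v : 'rV[R]_m, segment u v `<=` segment v u.
  by apply/seteqP; split; apply: sub.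
move=> u v _ [t /andP[t0 t1] <-]; exists (1 - t).
  by rewrite /= subr_ge0 t1 gerBl.
by rewrite subKr addrC.
Qed.

Lemma edist_eq0 p q : edist p q = 0 -> p = q.
Proof.
move=> /eqP; rewrite sqrtr_eq0 => le0; apply/rowP => i; apply/eqP.
rewrite -subr_eq0 -sqrf_eq0 eq_le sqr_ge0 andbT; apply: le_trans le0.
rewrite (bigD1 i) //= lerDl; apply: sumr_ge0 => j _; exact: sqr_ge0.
Qed.

Lemma isometry_inj f : Defs.isometry f -> injective f.
Proof.
move=> f_iso p q e; apply: edist_eq0; rewrite -f_iso e /edist.
by under eq_bigr do rewrite subrr expr0n; rewrite big1 ?sqrtr0.
Qed.

Variables (V : finType) (pt : V -> 'rV[R]_m) (f : 'rV[R]_m -> 'rV[R]_m) (g : V -> V).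
Hypothesis fpt : forall x, f (pt x) = pt (g x).

(** The images of segments are a hypothesis so that [f] need not be affine: a symmetry supplies them
    by preserving edges, a signed permutation by linearity. *)
Lemma geom_image_realise (H : graph V) :
  (forall e, e \in H.2 -> exists x y, e = [set x; y]%SET) ->
  (forall x y, [set x; y]%SET \in H.2 ->
     f @` segment (pt x) (pt y) = segment (pt (g x)) (pt (g y))) ->
  geom_image f (realise pt H) = realise pt (map_graph g H).
Proof.
move=> pairs fseg; congr (_, _); apply/seteqP; split.
- by move=> _ [_ [x /= xH <-] <-]; exists (g x); rewrite ?fpt //=; apply: imset_f.
- move=> _ [y /= /imsetP[x xH ->] <-]; exists (pt x); last exact: fpt.
  by exists x.
- move=> _ [_ [x [y [xyH ->]]] <-]; exists (g x), (g y); split; last exact: fseg.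
  apply/imsetP; exists [set x; y]%SET => //; rewrite imsetU1 imset_set1 //.
move=> _ [u [v [/imsetP[e eH uv] ->]]].
have [x [y exy]] := pairs e eH; move: uv eH; rewrite exy imsetU1 imset_set1.
move=> uv xyH; exists (segment (pt x) (pt y)); first by exists x, y.
rewrite fseg //; case: (set2_eqP uv) => -[-> ->] //; exact: segment_sym.
Qed.

Lemma geom_image_realise_set (A : {set graph V}) :
  (forall H, H \in A -> geom_image f (realise pt H) = realise pt (map_graph g H)) ->
  geom_image f @` realise_set pt A = realise_set pt (map_graph g @: A).
Proof.
move=> fH; apply/seteqP; split.
  move=> _ [_ [H /= HA <-] <-]; exists (map_graph g H); last by rewrite fH.
  exact: imset_f.
move=> _ [_ /= /imsetP[H HA ->] <-]; exists (realise pt H); last exact: fH.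
by exists H.
Qed.

End Realisation.

(** * Signed permutations of the coordinates as isometries *)

Section SignedPermutation.

Variables (R : realType) (p : 'S_4) (w : vertex).

Definition signed_perm (v : 'rV[R]_4) : 'rV[R]_4 := \row_i ((-1) ^+ w i * v 0 (p i)).

Lemma signed_perm_isometry : Defs.isometry signed_perm.
Proof.
move=> u v; rewrite /edist; congr Num.sqrt.
rewrite [RHS](reindex_inj (@perm_inj _ p)) /=; apply: eq_bigr => i _.
by rewrite !mxE -mulrBr exprMn -exprM mulnC exprM sqrrN expr1n expr1n mul1r.
Qed.

Lemma signed_perm_pt x :
  signed_perm (cube_pt R x) = cube_pt R [ffun i => w i (+) x (p i)].
Proof. by apply/rowP => i; rewrite !mxE ffunE signr_addb. Qed.

Lemma signed_perm_segment u v :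
  signed_perm @` segment u v = segment (signed_perm u) (signed_perm v).
Proof.
have lin t : signed_perm ((1 - t) *: u + t *: v) =
    (1 - t) *: signed_perm u + t *: signed_perm v.
  by apply/rowP => i; rewrite !mxE; ring.
apply/seteqP; split.
  by move=> _ [_ [t t01 <-] <-]; exists t.
by move=> _ [t t01 <-]; exists ((1 - t) *: u + t *: v) => //; exists t.
Qed.

End SignedPermutation.

(** * Flag orbits and chirality *)

Section Chirality.

Variables (R : realType) (c : colouring) (hc : chiral_colouring c).
Local Notation pt := (cube_pt R).
Local Notation le := (@subgraph_of vertex).
Local Notation flag_of := (flag_of (nb (col_inj hc))).
Local Notation hand := (hand (col_inj hc)).

Definition cube_map (g : vertex -> vertex) : Prop :=
  forall x i, [set g x; g (flip x i)]%SET \in cube_edges.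

Lemma map_graph_cube g (H : graph vertex) : cube_map g ->
  H.2 \subset cube_edges -> (map_graph g H).2 \subset cube_edges.
Proof.
move=> g_edge /fintype.subsetP sH; apply/fintype.subsetP => _ /imsetP[e /sH +->].
by case/cube_edgesP => x [i ->]; rewrite imsetU1 imset_set1.
Qed.

Lemma realise_set_cube_inj (A B : {set graph vertex}) :
  (forall H, H \in A -> H.2 \subset cube_edges) ->
  (forall H, H \in B -> H.2 \subset cube_edges) ->
  realise_set pt A = realise_set pt B -> A = B.
Proof.
have sub (A' B' : {set graph vertex}) :
    (forall H, H \in A' -> H.2 \subset cube_edges) ->
    (forall H, H \in B' -> H.2 \subset cube_edges) ->
    realise_set pt A' `<=` realise_set pt B' -> A' \subset B'.
  move=> cA cB sAB; apply/fintype.subsetP => H HA.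
  have [|K /= KB e] := sAB (realise pt H); first by exists H.
  by rewrite -(@realise_cube_inj R _ _ (cB _ KB) (cA _ HA) e).
move=> cA cB e; apply/eqP; rewrite finset.eqEsubset.
by rewrite !sub // e.
Qed.

(** Faces of rank 0 give [g]; faces of rank 1 show that [g] preserves adjacency and that [f] carries
    the segment of an edge to that of its image. *)
Lemma symmetry_vertex_map f : symmetry pt le (Qhat c) f ->
  exists g, [/\ injective g, cube_map g & forall H : graph vertex,
    H.2 \subset cube_edges ->
    geom_image f (realise pt H) = realise pt (map_graph g H)].
Proof.
move=> [f_iso f_rank].
have {}f_rank (k : int) F : F \in Qhat_rank c k -> exists2 F', F' \in Qhat_rank c k &
    geom_image f (realise pt F) = realise pt F'.
  move=> Fk; have := f_rank k; rewrite faces_of_rank_Qhat // => e.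
  have : (geom_image f @` realise_set pt (Qhat_rank c k)) (geom_image f (realise pt F)).
    by exists (realise pt F) => //; exists F.
  by rewrite e => -[F' /= F'k <-]; exists F'.
have /choice[g fg] : forall x, exists y, f (pt x) = pt y.
  move=> x; have [|F'] := @f_rank 0%N ([set x]%SET, finset.set0).
    exact: imset_f.
  case/imsetP => y _ -> [e _]; exists y.
  have : ([set f p | p in [set pt z | z in [set` [set x]%SET]]]) (f (pt x)).
    by exists (pt x) => //; exists x; rewrite //= set11.
  by rewrite e => -[z /= /set1P -> ->].
have g_inj : injective g.
  move=> x y e; apply: (@cube_pt_inj R); apply: (isometry_inj f_iso).
  by rewrite !fg e.
have edge x i : [set g x; g (flip x i)]%SET \in cube_edges /\
    f @` segment (pt x) (pt (flip x i)) = segment (pt (g x)) (pt (g (flip x i))).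
  have [|F'] := @f_rank 1%N ([set x; flip x i]%SET, [set [set x; flip x i]%SET]%SET).
    by apply: imset_f; apply: cube_edge.
  case/imsetP => e e_edge -> [e1 e2].
  have ge : e = [set g x; g (flip x i)]%SET.
    apply/setP => z; apply/idP/idP => [ze|].
      have : ([set pt z | z in [set` e]]) (pt z) by exists z.
      rewrite -e1 => -[_ [u /= /set2P xu <-]]; rewrite fg => /cube_pt_inj <-.
      by case: xu => ->; rewrite ?set21 ?set22.
    suff ze u : u \in [set x; flip x i]%SET -> g u \in e.
      by case/set2P => ->; rewrite ze ?set21 ?set22.
    move=> xu; have : ([set pt z | z in [set` e]]) (pt (g u)).
      by rewrite -e1; exists (pt u); rewrite ?fg //; exists u.
    by move=> [v /= ve /cube_pt_inj <-].
  split; first by rewrite -ge.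
  have : ([set f @` s | s in (realise pt ([set x; flip x i]%SET,
      [set [set x; flip x i]%SET]%SET)).2]) (f @` segment (pt x) (pt (flip x i))).
    exists (segment (pt x) (pt (flip x i))) => //.
    by exists x, (flip x i); rewrite set11.
  rewrite e2 => -[u [v [/set1P uve ->]]].
  by move: uve; rewrite ge => /set2_eqP[[-> ->]|[-> ->]] //; apply: segment_sym.
exists g; split=> // [x i|H /fintype.subsetP sH]; first by case: (edge x i).
apply: geom_image_realise => // [e /sH /cube_edgesP[x [i ->]]|x y /sH].
  by exists x, (flip x i).
by case/cube_edge_pairP => i ->; case: (edge x i).
Qed.

Lemma flag_of_edges x s F : F \in flag_of x s -> F.2 \subset cube_edges.
Proof. by case/flag_of_Qhat_rank => k; apply: (Qhat_rank_edges hc). Qed.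

(** Realisation is injective on subgraphs of the cube, so the geometric equalities descend to
    equalities for [map_graph g]. *)
Lemma symmetry_hand f x y s t : symmetry pt le (Qhat c) f ->
  geom_image f @` realise_set pt (flag_of x s) = realise_set pt (flag_of y t) ->
  hand x s = hand y t.
Proof.
move=> fS; have [g [g_inj g_cube gE]] := symmetry_vertex_map fS.
have image_eq (A B : {set graph vertex}) :
    (forall H, H \in A -> H.2 \subset cube_edges) ->
    (forall H, H \in B -> H.2 \subset cube_edges) ->
    geom_image f @` realise_set pt A = realise_set pt B ->
    (map_graph g @: A)%SET = B.
  move=> cA cB; rewrite (@geom_image_realise_set _ _ _ _ _ g) => [|H HA].
    apply: realise_set_cube_inj => // _ /imsetP[H HA ->].
    by apply: map_graph_cube => //; apply: cA.
  by apply: gE; apply: cA.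
move=> e; apply: (@map_flag_of_hand c hc g) => // [k|].
  have [_ /(_ k)] := fS; rewrite faces_of_rank_Qhat // => /image_eq-> // H;
  exact: (Qhat_rank_edges hc).
by apply: image_eq e => H; apply: flag_of_edges.
Qed.

Lemma hand_symmetry x y s t : hand x s = hand y t ->
  exists2 f, symmetry pt le (Qhat c) f &
    geom_image f @` realise_set pt (flag_of x s) = realise_set pt (flag_of y t).
Proof.
move=> /hand_transitive[p [w [g_rank g_flag]]].
set g := (fun z => _) in g_rank g_flag.
have gE (H : graph vertex) : H.2 \subset cube_edges ->
    geom_image (signed_perm p w) (realise pt H) = realise pt (map_graph g H).
  move=> /fintype.subsetP sH.
  apply: geom_image_realise => [z|e /sH/cube_edgesP[z [i ->]]|z z' _].
  - exact: signed_perm_pt.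
  - by exists z, (flip z i).
  by rewrite signed_perm_segment !signed_perm_pt.
exists (signed_perm p w).
  split=> [|k]; first exact: signed_perm_isometry.
  rewrite faces_of_rank_Qhat // (@geom_image_realise_set _ _ _ _ _ g) ?g_rank //.
  by move=> H Hk; apply: gE; apply: Qhat_rank_edges Hk.
rewrite (@geom_image_realise_set _ _ _ _ _ g) ?g_flag // => H HPhi.
by apply: gE; apply: flag_of_edges HPhi.
Qed.

Lemma flag_orbitP x s y t :
  flag_orbit pt le (Qhat c) (flag_of x s) (flag_of y t) <-> hand x s = hand y t.
Proof.
split=> [[_ [f fS]]|/hand_symmetry[f fS e]]; first exact: symmetry_hand.
by split; [apply/flag_Qhat; exists y, t|exists f].
Qed.

Lemma flag_orbit_eq x s y t :
  flag_orbit pt le (Qhat c) (flag_of x s) = flag_orbit pt le (Qhat c) (flag_of y t)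
  <-> hand x s = hand y t.
Proof.
split=> [e|h]; first by apply/flag_orbitP; rewrite e; apply/flag_orbitP.
apply/seteqP; split=> Psi hPsi; have [/(flag_Qhat hc)[z [r e]] _] := hPsi;
  move: hPsi; rewrite e => /flag_orbitP h'; apply/flag_orbitP.
  by rewrite -h.
by rewrite h.
Qed.

Lemma Qhat_chiral : geometrically_chiral pt le (Qhat c).
Proof.
split; last first.
  move=> _ _ /(flag_Qhat hc)[x [s ->]] /(flag_Qhat hc)[y [t ->]] /hand_adjacent h.
  by move=> /flag_orbit_eq; rewrite h; case: (hand x s).
set x0 : vertex := [ffun=> false].
(* Two orderings at one vertex that differ by an adjacent swap represent the two hands; only the
   indices 0 and 1 matter. *)
pose t (i : nat) : 'S_4 := if i == 0%N then 1%g else tperm ord0 o1.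
have hand_t i : hand x0 (t i) = hand x0 1%g (+) (i != 0%N).
  rewrite /t; case: eqP => _ /=; first by rewrite addbF.
  by rewrite -[tperm _ _]mulg1 (hand_tperm (col_flip c) (col_inj hc) (col_square hc)) ?addbT.
have -> : [set flag_orbit pt le (Qhat c) Phi | Phi in [set Phi | flag le (Qhat c) Phi]]
    = (fun i => flag_orbit pt le (Qhat c) (flag_of x0 (t i))) @` `I_2.
  apply/seteqP; split=> [_ [Phi /= /(flag_Qhat hc)[x [s ->]] <-]|_ [i _ <-]].
    (* Read as a number, this boolean is 0 when the flag has the hand of the base flag and 1
       otherwise. *)
    exists (hand x s != hand x0 1%g); first by rewrite /=; case: eqP.
    apply/flag_orbit_eq; rewrite hand_t.
    by case: (hand x s); case: (hand x0 1%g).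
  by exists (flag_of x0 (t i)) => //=; apply/(flag_Qhat hc); exists x0, (t i).
apply: inj_card_eq => i j; rewrite !inE /= => i2 j2 /flag_orbit_eq.
by rewrite !hand_t => /addbI; case: i i2 => [|[|]] //; case: j j2 => [|[|]].
Qed.

End Chirality.

Theorem theorem2 (R : realType) (c : colouring) (hc : chiral_colouring c) :
  (forall k : int,
     faces_of_rank (@subgraph_of vertex) (Qhat c) k = Qhat_rank c k) /\
  chiral_polytope_of_full_rank (n := 4) (cube_pt R) (@subgraph_of vertex) (Qhat c).
Proof.
split; first exact: faces_of_rank_Qhat.
by split; [apply: Qhat_polytope|apply: Qhat_chiral].
Qed.
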